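(* Let $\mathcal{C}$ be a $3$-uniform clutter on a vertex set $V=\{v_1,\ldots,v_n\}$, let $I=I(\mathcal{C})\subseteq\mathbb{K}[x_1,\ldots,x_n]$ be the corresponding edge ideal, and let $\mathscr{C}=\{\mathcal{B},\mathcal{B}_1,\mathcal{B}_2,\mathcal{B}'\}$ be the family of four $3$-uniform clutters defined in the context. The following conditions are equivalent: (a) the complement $\bar{\mathcal{C}}$ is $\mathscr{C}$-free; (b) $\mathrm{index}(I^k)>1$ for some $k\geq 1$.
   Context: $\mathbb{K}$ is a field and $S=\mathbb{K}[x_1,\ldots,x_n]$ has the standard grading; all ideals whose index is considered are nonzero. A $3$-uniform clutter $\mathcal{C}$ on a finite vertex set $V=\{v_1,\dots,v_n\}$ is a collection of $3$-subsets of $V$ (circuits) with $V=\bigcup\mathcal{C}$. Its edge ideal is $I(\mathcal{C})=(x_ix_jx_k : \{v_i,v_j,v_k\}\in\mathcal{C})$. Its complement is $\bar{\mathcal{C}}=\{F\subset V: |F|=3,\ F\notin\mathcal{C}\}$. Induced subclutters: for $W\subseteq V$, $\bar{\mathcal{C}}[W]=\{F\in\bar{\mathcal{C}}: F\subseteq W\}$. For a family $\mathscr{F}$ of clutters, a clutter is $\mathscr{F}$-free if it has no induced subclutter isomorphic to a member of $\mathscr{F}$, i.e. there are no $W\subseteq V$ and $\mathcal{D}\in\mathscr{F}$ with a bijection from $W$ onto the vertex set $\bigcup\mathcal{D}$ carrying the induced subclutter on $W$ onto $\mathcal{D}$. The family $\mathscr{C}=\{\mathcal{B},\mathcal{B}_1,\mathcal{B}_2,\mathcal{B}'\}$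 (writing $abc$ for $\{a,b,c\}$): $\mathcal{B}=\{123,124,134,235,245,345\}$, $\mathcal{B}_1=\mathcal{B}\cup\{125\}$, $\mathcal{B}_2=\mathcal{B}\cup\{125,135\}$, and $\mathcal{B}'=\binom{[6]}{3}\setminus\{123,456\}$, the set of all $3$-subsets of $\{1,\dots,6\}$ other than $123$ and $456$. Graded Betti numbers: $\beta_{i,j}(I)=\dim_{\mathbb{K}}\mathrm{Tor}^S_i(\mathbb{K},I)_j$ (Betti numbers of the module $I$). A nonzero monomial ideal $I$ is $r$-step linear if it is generated in a single degree $d$ and $\beta_{i,j}(I)=0$ for all $(i,j)$ with $0\le i\le r$ and $j-i>d$; the Green-Lazarsfeld index is $\mathrm{index}(I)=\sup\{r: I\text{ is }r\text{-step linear}\}+1$ (possibly $\infty$). *)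

(* Defs.v *)
From HB Require Import structures.
From mathcomp Require Import all_boot all_order all_algebra.
From mathcomp Require Import boolp classical_sets.
From mathcomp Require Import mpoly.
(* The notations of constructive_ereal are incompatible with those of mpoly. *)
From mathcomp Require constructive_ereal.
Import -(notations) constructive_ereal.

Set Implicit Arguments.
Unset Strict Implicit.
Unset Printing Implicit Defensive.

Import Order.TTheory GRing.Theory Num.Theory.

Local Open Scope ring_scope.
Local Open Scope classical_set_scope.

Definition ideal_gen (R : comNzRingType) (G : set R) : set R :=
  [set p | exists m (a g : 'I_m -> R),
     (forall i, G (g i)) /\ p = \sum_(i < m) a i * g i].

Definition ideal_mul (R : comNzRingType) (I J : set R) : set R :=
  ideal_gen [set p | exists x y, [/\ I x, J y & p = x * y]].

Definition ideal_exp (R : comNzRingType) (I : set R) (k : nat) : set R :=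
  iter k (ideal_mul I) [set: R].

(* f induces a basis of Z / B, for subspaces B `<=` Z of V *)
Definition basis_mod (K : fieldType) (V : lmodType K) (Z B : set V) (m : nat)
    (f : 'I_m -> V) : Prop :=
  [/\ forall i, Z (f i),
      forall c : 'I_m -> K, B (\sum_i c i *: f i) -> forall i, c i = 0
    & forall z, Z z -> exists c : 'I_m -> K, B (z - \sum_i c i *: f i)].

(* dim_K (Z / B), which is +oo when Z / B has no finite basis *)
Definition dim_mod (K : fieldType) (V : lmodType K) (Z B : set V) :
    extended nat :=
  xget (EPInf nat)
    [set x | exists m (f : 'I_m -> V), basis_mod Z B f /\ x = EFin m].

(* the degree d component of S(-e) *)
Definition shift_homog (K : fieldType) (n : nat) (d e : nat) :
    set {mpoly K[n]} :=
  [set p | if (e <= d)%N then p \is (d - e)%N.-homog else p == 0].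

(* the S-linear map sending the basis vector a to \sum_b M a b *: b *)
Definition free_map (R : comNzRingType) (A B : finType) (M : A -> B -> R)
    (v : {ffun A -> R}) : {ffun B -> R} :=
  [ffun b => \sum_a v a * M a b].

(* The i-th free module has basis res_basis i, whose element b has degree
   res_deg b. In res_aug_exact, S acts on K through p |-> p@_0. *)
Record graded_free_resolution (K : fieldType) (n : nat) := GradedFreeResolution {
  res_basis : nat -> finType;
  res_deg : forall i, res_basis i -> nat;
  res_diff : forall i, res_basis i.+1 -> res_basis i -> {mpoly K[n]};
  res_aug : res_basis 0 -> K;
  res_diff_homog : forall i (a : res_basis i.+1) (b : res_basis i),
    shift_homog (res_deg a) (res_deg b) (res_diff a b);
  res_aug_homog : forall b, res_aug b != 0 -> res_deg b = 0%N;
  res_aug_surj : exists b, res_aug b != 0;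
  res_aug_exact : forall v : {ffun res_basis 0 -> {mpoly K[n]}},
    \sum_b (v b)@_0%MM * res_aug b = 0 <->
    exists w, v = free_map (@res_diff 0) w;
  res_exact : forall i (v : {ffun res_basis i.+1 -> {mpoly K[n]}}),
    free_map (@res_diff i) v = 0 <->
    exists w, v = free_map (@res_diff i.+1) w }.

Section Tor.
Context (K : fieldType) (n : nat) (F : graded_free_resolution K n).
Context (I : set {mpoly K[n]}).

Let FS i := {ffun res_basis F i -> {mpoly K[n]}}.

(* As F i is free on res_basis F i, the tensor product of F i and the ideal I
   consists of the families of elements of I indexed by res_basis F i. *)
Definition tor_chains (i j : nat) : set (FS i) :=
  [set v | forall b, I (v b) /\ shift_homog j (res_deg b) (v b)].

Definition tor_cycles (i j : nat) : set (FS i) :=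
  match i return set (FS i) with
  | 0 => @tor_chains 0 j
  | i'.+1 => @tor_chains i'.+1 j `&`
             [set v | free_map (@res_diff K n F i') v = 0]
  end.

Definition tor_boundaries (i j : nat) : set (FS i) :=
  free_map (@res_diff K n F i) @` @tor_chains i.+1 j.

Definition tor_dim (i j : nat) : extended nat :=
  dim_mod (@tor_cycles i j) (@tor_boundaries i j).

End Tor.

Definition koszul_basis (n i : nat) : finType := {s : {set 'I_n} | #|s| == i}.

(* e_s |-> \sum_(k in s) (-1)^#{l in s : l < k} x_k e_(s \ k) *)
Definition koszul_coef (K : fieldType) (n : nat) (s t : {set 'I_n}) :
    {mpoly K[n]} :=
  \sum_(k in s | s :\ k == t)
     (-1) ^+ #|[set l in s | (l < k)%N]%SET| * 'X_k.

Definition koszul_diff (K : fieldType) (n i : nat)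
    (a : koszul_basis n i.+1) (b : koszul_basis n i) : {mpoly K[n]} :=
  koszul_coef K (val a) (val b).

Lemma koszul_homog (K : fieldType) n i
    (a : koszul_basis n i.+1) (b : koszul_basis n i) :
  shift_homog i.+1 i (koszul_diff K a b).
Proof.
rewrite /shift_homog /= leqnSn subSnn /koszul_diff /koszul_coef.
apply: rpred_sum => k _; rewrite -signr_odd.
have hX : ('X_k : {mpoly K[n]}) \is 1.-homog by rewrite dhomogX /= mdeg1.
by case: odd; rewrite ?expr0 ?expr1 ?mul1r ?mulN1r ?dhomogN.
Qed.

Section KoszulExact.
Import mathcomp.boot.finset.
Context (K : fieldType) (n : nat).
Local Notation S := {mpoly K[n]}.
Local Notation T := {set 'I_n}.

Let sg (k : 'I_n) (t : T) : S := (-1) ^+ #|[set l in t | (l < k)%N]%SET|.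

Let D (V : T -> S) (t : T) : S :=
  \sum_(k | k \notin t) V (k |: t)%SET * (sg k t * 'X_k).

Let ext i (v : {ffun koszul_basis n i -> S}) (s : T) : S := oapp v 0 (insub s).

Let ext_val i (v : {ffun koszul_basis n i -> S}) (a : koszul_basis n i) : ext v (val a) = v a.
Proof. by rewrite /ext valK. Qed.

Let ext0 i (v : {ffun koszul_basis n i -> S}) (s : T) : #|s| != i -> ext v s = 0.
Proof. by move=> h; rewrite /ext insubF //; apply/negbTE. Qed.

Let sgU k (t : T) : k \notin t -> sg k (k |: t)%SET = sg k t.
Proof.
move=> kt; rewrite /sg; congr (_ ^+ _); apply: eq_card => l.
by rewrite !inE; case: eqVneq => //= ->; rewrite ltnn andbF.
Qed.

Let free_mapE i (v : {ffun koszul_basis n i.+1 -> S}) (b : koszul_basis n i) :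
  free_map (@koszul_diff K n i) v b = D (ext v) (val b).
Proof.
rewrite ffunE.
transitivity (\sum_(s : T | #|s| == i.+1) ext v s * koszul_coef K s (val b)).
  rewrite (reindex_omap (val : koszul_basis n i.+1 -> T) insub) /=.
    apply: eq_big => [a|a _]; first by rewrite valK eqxx (valP a).
    by rewrite ext_val.
  by move=> s hs; rewrite insubT.
transitivity (\sum_(s : T) \sum_(k in s | s :\ k == val b)
    ext v s * (sg k s * 'X_k)).
  rewrite [LHS]big_mkcond /=; apply: eq_bigr => s _.
  case: ifPn => hs; first by rewrite mulr_sumr.
  by rewrite big1 // => k _; rewrite ext0 ?mul0r.
under eq_bigr => s _ do rewrite big_mkcond /=.
rewrite exchange_big /= /D [RHS]big_mkcond /=; apply: eq_bigr => k _.
case: ifPn => kb; last first.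
  rewrite big1 // => s _; case: ifP => // /andP[_ /eqP e].
  by move: kb; rewrite negbK -e setD11.
rewrite -sgU // (bigD1 (k |: val b)%SET) //= setU11 setU1K // eqxx big1 ?addr0 //.
move=> s hs; case: ifP => // /andP[ks /eqP e].
by move: hs; rewrite -e setD1K // eqxx.
Qed.

Let sg_swap (t : T) k l : k \notin t -> l \notin t -> (k < l)%N ->
  sg l (k |: t)%SET * sg k t = - (sg k (l |: t)%SET * sg l t).
Proof.
move=> kt lt kl.
have -> : sg k (l |: t)%SET = sg k t.
  rewrite /sg; congr (_ ^+ _); apply: eq_card => m; rewrite !inE.
  by case: eqVneq => //= ->; rewrite ltnNge (ltnW kl) andbF.
have -> : sg l (k |: t)%SET = - sg l t.
  rewrite /sg (cardsD1 k) !inE eqxx kl /= add1n exprS mulN1r.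
  congr (- (_ ^+ _)); apply: eq_card => m; rewrite !inE.
  by case: eqVneq => [->|]//=; rewrite (negbTE kt).
by rewrite mulNr mulrC.
Qed.

Let DD0 (V : T -> S) t : D (D V) t = 0.
Proof.
pose f k l := V (l |: (k |: t))%SET * (sg l (k |: t)%SET * 'X_l) * (sg k t * 'X_k).
have E : D (D V) t = \sum_k \sum_(l | [&& k \notin t, l \notin t & k != l]) f k l.
  rewrite /D big_mkcond /=; apply: eq_bigr => k _.
  case: ifPn => kt; last by rewrite big_pred0 // => l; rewrite /= (negbTE kt).
  rewrite mulr_suml; apply: eq_bigl => l.
  by rewrite !inE negb_or /= andbC eq_sym.
have fN k l : k \notin t -> l \notin t -> (k < l)%N -> f k l = - f l k.
  move=> kt lt kl; rewrite /f setUCA -!mulrA -mulrN; congr (_ * _).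
  have := sg_swap kt lt kl; set a := sg l _; set b := sg k t.
  set c := sg k _; set d := sg l t => e.
  by rewrite ['X_l * _]mulrCA ['X_k * _]mulrCA ['X_k * _]mulrC !mulrA e !mulNr.
rewrite E.
have -> : \sum_k \sum_(l | [&& k \notin t, l \notin t & k != l]) f k l =
  \sum_k \sum_(l | [&& k \notin t, l \notin t & (k < l)%N]) f k l +
  \sum_k \sum_(l | [&& k \notin t, l \notin t & (l < k)%N]) f k l.
  rewrite -big_split /=; apply: eq_bigr => k _.
  rewrite (bigID (fun l : 'I_n => (k < l)%N)) /=; congr (_ + _); apply: eq_bigl => l.
    by case: (k \notin t) => //; case: (l \notin t) => //=; rewrite -val_eqE /=; case: ltngtP.
  by case: (k \notin t) => //; case: (l \notin t) => //=; rewrite -val_eqE /=; case: ltngtP.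
have -> : \sum_k \sum_(l | [&& k \notin t, l \notin t & (l < k)%N]) f k l =
  \sum_k \sum_(l | [&& k \notin t, l \notin t & (k < l)%N]) f l k.
  under eq_bigr => k _ do rewrite big_mkcond /=.
  rewrite exchange_big /=; apply: eq_bigr => k _; rewrite -big_mkcond /=.
  by apply: eq_bigl => l; rewrite andbCA.
rewrite -big_split big1 // => k _; rewrite -big_split big1 // => l /and3P[kt lt kl] /=.
by rewrite fN // addNr.
Qed.

(* contracting homotopy: X^u e_s |-> X^(u - k) e_(s + k) if k, the least
   element of the union of s and the support of u, is not in s *)
Let phi (k : 'I_n) (p : S) : S :=
  \sum_(m <- msupp p | [forall l : 'I_n, (l < k)%N ==> (m l == 0%N)] && (0 < m k)%N)
     p@_m *: 'X_[m - U_(k)].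

Let phiE k p m : (phi k p)@_m =
  if [forall l : 'I_n, (l < k)%N ==> (m l == 0%N)] then p@_(m + U_(k)) else 0.
Proof.
rewrite /phi raddf_sum /=.
under eq_bigr => u _ do rewrite mcoeffZ mcoeffX.
have lowE (u : 'X_{1..n}) : (0 < u k)%N -> (u - U_(k))%MM = m -> u = (m + U_(k))%MM.
  move=> uk <-; apply/mnmP => l; rewrite mnmDE mnmBE mnm1E.
  by case: eqVneq => [<-|_] /=; rewrite ?subnK // subn0 addn0.
have lowD : [forall l : 'I_n, (l < k)%N ==> ((m + U_(k))%MM l == 0%N)]
          = [forall l : 'I_n, (l < k)%N ==> (m l == 0%N)].
  apply: eq_forallb => l; case: (ltnP l k) => //= lk.
  have kl : (k == l) = false by rewrite -(inj_eq val_inj) /= gtn_eqF.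
  by rewrite mnmDE mnm1E kl addn0.
have addK : (m + U_(k) - U_(k))%MM = m by rewrite addmK.
case: ifPn => hm; last first.
  rewrite big_seq_cond big1 // => u /andP[_ /andP[hu uk]].
  case: eqP => [e|_]; last by rewrite mulr0.
  by move: hu; rewrite (lowE u uk e) lowD (negbTE hm).
have [hin|hout] := boolP ((m + U_(k))%MM \in msupp p).
  rewrite big_mkcond (bigD1_seq (m + U_(k))%MM) ?msupp_uniq //=.
  rewrite lowD hm mnmDE mnm1E eqxx addn1 /= addK eqxx mulr1 big1 ?addr0 //.
  move=> u ne; case: ifP => // /andP[hu uk].
  case: eqP => [e|_]; last by rewrite mulr0.
  by move: ne; rewrite (lowE u uk e) eqxx.
rewrite (memN_msupp_eq0 hout) big_seq_cond big1 // => u /andP[uin /andP[hu uk]].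
case: eqP => [e|_]; last by rewrite mulr0.
by move: hout; rewrite -(lowE u uk e) uin.
Qed.

Let hty (V : T -> S) (s : T) : S :=
  if [pick r in s | [forall l in s, (r <= l)%N]] is Some r
  then phi r (V (s :\ r)%SET) else 0.

Let htyE V (s : T) r : r \in s -> (forall l, l \in s -> (r <= l)%N) ->
  hty V s = phi r (V (s :\ r)%SET).
Proof.
move=> rs rmin; rewrite /hty; case: pickP => [r' /andP[r's /forall_inP r'min]|].
  by have -> : r' = r by apply/val_inj/eqP; rewrite eqn_leq r'min ?rmin.
move/(_ r); rewrite /= rs /= => /negbT /forall_inPn[l ls].
by rewrite rmin.
Qed.

Let sgK (k : 'I_n) (t : T) : K := (-1) ^+ #|[set l in t | (l < k)%N]%SET|.

Let mcoeff_sgX (p : S) k (t : T) u : (p * (sg k t * 'X_k))@_u =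
  sgK k t * (if (0 < u k)%N then p@_(u - U_(k)) else 0).
Proof.
have -> : (p * (sg k t * 'X_k))@_u = sgK k t * (p * 'X_k)@_u.
  rewrite mulrCA /sg /sgK -signr_odd -[in RHS]signr_odd.
  by case: odd; rewrite ?expr0 ?expr1 ?mul1r // !mulN1r mcoeffN.
congr (_ * _); case: ifPn => uk.
  have e : (U_(k) + (u - U_(k)))%MM = u.
    apply/mnmP => l; rewrite mnmDE mnmBE mnm1E.
    by case: eqVneq => [<-|_] /=; rewrite ?subnKC // subn0.
  transitivity ((p * 'X_k)@_(U_(k) + (u - U_(k)))%MM); first by rewrite e.
  exact: mcoeffMX.
apply: memN_msupp_eq0; rewrite (perm_mem (msuppMX _ _)).
apply/mapP => -[m _ e]; move: uk.
by rewrite e mnmDE mnm1E eqxx add1n.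
Qed.

Let hty_contract (V : T -> S) (t : T) u : (forall s, D V s = 0) ->
  (t != set0) || (u != 0%MM) -> (D (hty V) t)@_u = (V t)@_u.
Proof.
move=> cyc ne.
have [q0 hq0] : exists q, (q \in t) || (0 < u q)%N.
  case/orP: ne => [/set0Pn[q qt]|une]; first by exists q; rewrite qt.
  apply/existsP; apply: contraNT une; rewrite negb_exists => /forallP h.
  apply/eqP/mnmP => l; rewrite mnmE; have := h l.
  by rewrite negb_or -leqNgt leqn0 => /andP[_ /eqP].
have [q hq qmin] : exists2 q : 'I_n, (q \in t) || (0 < u q)%N &
    forall l : 'I_n, (l \in t) || (0 < u l)%N -> (q <= l)%N.
  pose P (q : 'I_n) := (q \in t) || (0 < u q)%N.
  by case: (@arg_minnP _ q0 P (fun q => q : nat) hq0) => q; exists q.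
have [qt|qt] := boolP (q \in t).
- pose t' := (t :\ q)%SET.
  have := congr1 (mcoeff (u + U_(q))%MM) (cyc t').
  rewrite /D raddf_sum mcoeff0 (bigD1 q) ?setD11 //= setD1K // mcoeff_sgX.
  rewrite mnmDE mnm1E eqxx addn1 /= addmK.
  have -> : sgK q t' = 1.
    suff e0 : [set l in t' | (l < q)%N]%SET = set0 by rewrite /sgK e0 cards0.
    apply/setP => l; rewrite !inE; apply/negbTE/negP => /andP[/andP[_ lt] lq].
    by have := qmin l; rewrite lt => /(_ isT); rewrite leqNgt lq.
  rewrite mul1r => /eqP; rewrite addr_eq0 => /eqP ->.
  rewrite raddf_sum -sumrN; apply: eq_big => [k|k kt].
    rewrite !inE negb_and negbK; have [->|] //= := eqVneq k q.
      by rewrite qt.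
    by rewrite andbT.
  have kq : k != q by apply: contraNneq kt => ->.
  rewrite /= !mcoeff_sgX mnmDE mnm1E eq_sym (negbTE kq) addn0.
  case: ifPn => uk; last by rewrite !mulr0 oppr0.
  have qk : (q < k)%N.
    by rewrite ltn_neqAle eq_sym kq qmin // uk orbT.
  rewrite (@htyE _ _ q); first last.
  + by move=> l; rewrite !inE => /orP[/eqP->|lt]; rewrite qmin ?lt // uk orbT.
  + by rewrite !inE qt orbT.
  have low : [forall l : 'I_n, (l < q)%N ==> ((u - U_(k))%MM l == 0%N)].
    apply/forallP => l; apply/implyP => lq; rewrite mnmBE.
    have := qmin l; rewrite [(q <= l)%N]leqNgt lq.
    by case: (u l) => // m /(_ (orbT _)).
  rewrite phiE low.
  have -> : ((k |: t) :\ q = k |: t')%SET.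
    apply/setP => l; rewrite !inE.
    by have [->|] := eqVneq l q; rewrite //= eq_sym (negbTE kq).
  have -> : (u - U_(k) + U_(q) = u + U_(q) - U_(k))%MM.
    apply/mnmP => l; rewrite !(mnmDE, mnmBE) !mnm1E.
    have [<-|] := eqVneq k l; last by rewrite !subn0.
    by rewrite [q == k]eq_sym (negbTE kq) !addn0.
  rewrite -mulNr; congr (_ * _).
  rewrite /sgK (cardsD1 q) !inE qt qk /= add1n exprS mulN1r.
  congr (- (_ ^+ _)); apply: eq_card => l; rewrite !inE.
  by rewrite andbA.
- have uq : (0 < u q)%N by move: hq; rewrite (negbTE qt).
  rewrite /D raddf_sum (bigD1 q) //= mcoeff_sgX uq.
  rewrite big1 ?addr0 => [|k /andP[kt kq]].
    have -> : sgK q t = 1.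
      suff e0 : [set l in t | (l < q)%N]%SET = set0 by rewrite /sgK e0 cards0.
      apply/setP => l; rewrite !inE; apply/negbTE/negP => /andP[lt lq].
      by have := qmin l; rewrite lt => /(_ isT); rewrite leqNgt lq.
    rewrite mul1r (@htyE _ _ q) ?setU11 ?setU1K //; last first.
      by move=> l; rewrite !inE => /orP[/eqP->//|lt]; rewrite qmin ?lt.
    have low : [forall l : 'I_n, (l < q)%N ==> ((u - U_(q))%MM l == 0%N)].
      apply/forallP => l; apply/implyP => lq; rewrite mnmBE.
      have := qmin l; rewrite [(q <= l)%N]leqNgt lq.
      by case: (u l) => // m /(_ (orbT _)).
    rewrite phiE low; congr (_ @_ _); apply/mnmP => l; rewrite mnmDE mnmBE mnm1E.
    by case: eqVneq => [<-|_] /=; rewrite ?subnK // subn0 addn0.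
  rewrite mcoeff_sgX; case: ifPn => uk; last by rewrite mulr0.
  have kin : k \in (k |: t)%SET by rewrite setU11.
  case: (@arg_minnP _ k (mem (k |: t)%SET) (fun q => q : nat) kin) => r rin rmin.
  rewrite (htyE _ rin rmin) phiE ifF ?mulr0 //.
  apply/negbTE/negP => /forallP /(_ q).
  rewrite mnmBE mnm1E (negbTE kq) subn0 => /implyP h.
  suff /h : (q < r)%N by move=> /eqP h0; rewrite h0 in uq.
  move: rin; rewrite !inE => /orP[/eqP->|rt].
    by rewrite ltn_neqAle qmin ?uk ?orbT // andbT eq_sym val_eqE kq.
  rewrite ltn_neqAle qmin ?rt // andbT val_eqE.
  by apply: contraNneq qt => ->.
Qed.

Let hty_fun i (v : {ffun koszul_basis n i -> S}) :
  {ffun koszul_basis n i.+1 -> S} := [ffun a => hty (ext v) (val a)].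

Let ext_hty i (v : {ffun koszul_basis n i -> S}) (s : T) :
  ext (hty_fun v) s = hty (ext v) s.
Proof.
have [hs|hs] := boolP (#|s| == i.+1).
  by rewrite -[s]/(val (Sub s hs : koszul_basis n i.+1)) ext_val ffunE.
rewrite ext0 // /hty; case: pickP => // r /andP[rs _].
rewrite ext0; last by move: hs; rewrite (cardsD1 r s) rs.
by rewrite /phi msupp0 big_nil.
Qed.

Lemma koszul_aug_exact (v : {ffun koszul_basis n 0 -> S}) :
  \sum_b (v b)@_0%MM * 1 = 0 <->
  exists w, v = free_map (@koszul_diff K n 0) w.
Proof.
have b0 : #|set0 : T| == 0%N by rewrite cards0.
pose e : koszul_basis n 0 := Sub set0 b0.
have be (b : koszul_basis n 0) : b = e.
  by apply/val_inj/eqP; rewrite /= -cards_eq0 (valP b).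
have -> : \sum_b (v b)@_0%MM * 1 = (v e)@_0%MM.
  by rewrite (bigD1 e) //= mulr1 big1 ?addr0 // => b; rewrite (be b) eqxx.
split=> [v0|[w ->]]; last first.
  by rewrite free_mapE /D raddf_sum; apply: big1 => k _; rewrite /= mcoeff_sgX mnm0E mulr0.
exists (hty_fun v); apply/ffunP => b; rewrite free_mapE (be b) /=.
have -> : D (ext (hty_fun v)) set0 = D (hty (ext v)) set0.
  by apply: eq_bigr => k _; rewrite ext_hty.
apply/mpolyP => u; have [->|une] := eqVneq u 0%MM.
  by rewrite v0 /D; apply/esym; rewrite raddf_sum; apply: big1 => k _; rewrite /= mcoeff_sgX mnm0E mulr0.
rewrite hty_contract ?une ?orbT //; first by rewrite -(ext_val v e).
move=> s; rewrite /D big1 // => k ks; rewrite ext0 ?mul0r //.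
by rewrite cards_eq0; apply/set0Pn; exists k; rewrite setU11.
Qed.

Lemma koszul_exact i (v : {ffun koszul_basis n i.+1 -> S}) :
  free_map (@koszul_diff K n i) v = 0 <->
  exists w, v = free_map (@koszul_diff K n i.+1) w.
Proof.
split=> [v0|[w ->]]; last first.
  apply/ffunP => b; rewrite free_mapE ffunE -[RHS](DD0 (ext w) (val b)).
  apply: eq_bigr => k kb; congr (_ * _).
  have h : #|k |: val b|%SET == i.+1 by rewrite cardsU1 kb (eqP (valP b)).
  have e : (k |: val b)%SET = val (Sub (k |: val b)%SET h : koszul_basis n i.+1) by [].
  by rewrite [in LHS]e ext_val free_mapE -e.
exists (hty_fun v); apply/ffunP => b; rewrite free_mapE.
have -> : D (ext (hty_fun v)) (val b) = D (hty (ext v)) (val b).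
  by apply: eq_bigr => k _; rewrite ext_hty.
apply/mpolyP => u; rewrite hty_contract ?ext_val //; last first.
  by rewrite -cards_eq0 (eqP (valP b)).
move=> s; have [hs|hs] := boolP (#|s| == i).
  by rewrite -[s]/(val (Sub s hs : koszul_basis n i)) -free_mapE v0 ffunE.
rewrite /D big1 // => k ks; rewrite ext0 ?mul0r //.
by rewrite cardsU1 ks.
Qed.

End KoszulExact.

Lemma koszul_aug_surj (K : fieldType) n :
  exists b : koszul_basis n 0, (1 : K) != 0.
Proof.
have b0 : #|finset.set0 : {set 'I_n}| == 0%N by rewrite cards0.
by exists (Sub finset.set0 b0); rewrite oner_eq0.
Qed.

Definition koszul_resolution (K : fieldType) (n : nat) :
    graded_free_resolution K n :=
  @GradedFreeResolution K n (koszul_basis n) (fun i _ => i) (@koszul_diff K n)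
    (fun _ => 1) (@koszul_homog K n) (fun _ _ => erefl) (koszul_aug_surj K n)
    (@koszul_aug_exact K n) (@koszul_exact K n).

(* dim_K Tor_i(K, I)_j *)
Definition betti (K : fieldType) (n : nat) (I : set {mpoly K[n]}) (i j : nat) :
    extended nat :=
  tor_dim (koszul_resolution K n) I i j.

Definition generated_in_degree (K : fieldType) (n : nat) (I : set {mpoly K[n]})
    (d : nat) : Prop :=
  I = ideal_gen [set p | I p /\ p \is d.-homog].

Definition step_linear (K : fieldType) (n : nat) (I : set {mpoly K[n]})
    (r : nat) : Prop :=
  exists d, generated_in_degree I d /\
    forall i j, (i <= r)%N -> (i + d < j)%N -> betti I i j = EFin 0%N.

Definition GL_index (K : fieldType) (n : nat) (I : set {mpoly K[n]}) :
    extended int :=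
  adde (supremum (ENInf int) [set EFin r%:Z | r in step_linear I]) (EFin 1).

Definition uniform3_clutter (T : finType) (C : {set {set T}}) : Prop :=
  (forall F, F \in C -> #|F| = 3%N) /\ finset.cover C = [set: T]%SET.

Definition edge_ideal (K : fieldType) (n : nat) (C : {set {set 'I_n}}) :
    set {mpoly K[n]} :=
  ideal_gen [set p | exists2 F, F \in C & p = \prod_(v in F) 'X_v].

Arguments edge_ideal K {n} C.

Definition complement3 (T : finType) (C : {set {set T}}) : {set {set T}} :=
  [set F : {set T} | (#|F| == 3%N) && (F \notin C)]%SET.

(* The vertex set of D is finset.cover D. *)
Definition induced_iso (T U : finType) (C : {set {set T}}) (W : {set T})
    (D : {set {set U}}) : Prop :=
  exists f : T -> U,
    [/\ {in W &, injective f}, (f @: W)%SET = finset.cover D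
      & [set (f @: F)%SET | F : {set T} in C ::&: W]%SET = D].

Definition clutter_free (T U : finType) (family : seq {set {set U}})
    (C : {set {set T}}) : Prop :=
  ~ exists W D, D \in family /\ induced_iso C W D.

(* The vertices 1, ..., 6 are elements of 'I_7, in which 0 is not used. *)
Definition tri (a b c : nat) : {set 'I_7} :=
  [set inord a; inord b; inord c]%SET.

Definition clutter_B : {set {set 'I_7}} :=
  [set tri 1 2 3; tri 1 2 4; tri 1 3 4; tri 2 3 5; tri 2 4 5; tri 3 4 5]%SET.

Definition clutter_B1 : {set {set 'I_7}} := (clutter_B :|: [set tri 1 2 5])%SET.

Definition clutter_B2 : {set {set 'I_7}} :=
  (clutter_B :|: [set tri 1 2 5; tri 1 3 5])%SET.

Definition clutter_B' : {set {set 'I_7}} :=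
  ([set F : {set 'I_7} | (#|F| == 3%N) && (ord0 \notin F)]
     :\: [set tri 1 2 3; tri 4 5 6])%SET.

Definition clutter_family : seq {set {set 'I_7}} :=
  [:: clutter_B; clutter_B1; clutter_B2; clutter_B'].

(* Main.v *)
Require Import Defs.
From mathcomp Require Import all_boot all_order all_algebra.
From mathcomp Require Import boolp classical_sets.
From mathcomp Require Import mpoly.
From mathcomp Require constructive_ereal.
Import -(notations) constructive_ereal.
From mathcomp Require Import zify.

(** Both conditions are compared with a third one, on the circuits of [C]: call
    [C] separated when it has circuits [u] and [v] with at least two vertices
    in [v \ u] such that every circuit inside the union of [u] and [v], other
    than [u] itself, contains all of [v \ u].

    Homologically, the Koszul complex tensored with a monomial ideal splits
    along monomials [L], and its degree 1 homology at [L] is the reduced zeroth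
    homology of a graph on the variables: [k] is a vertex when [L / x_k] is in
    the ideal, and [k], [l] are joined when [L / (x_k x_l)] is
    ([betti1_eq0], [betti1_neq0]).  So linear presentation in degree [d] means
    that these graphs are connected for all [L] of degree above [d + 1].

    If [C] is separated by [u] and [v], put [P = v \ u] and
    [L = u^k (product of P)].  A generator of the [k]-th power supported on the
    union of [u] and [v] is either [u^k] or divisible by the product of [P],
    and [L] contains each variable of [P] only once.  Hence no edge of the graph
    at [L] leaves [P], while [u \ v] supplies a vertex outside [P]: the graph is
    disconnected, in degree at least [3k + 2], and no power of the ideal is
    linearly presented ([separated_betti]).

    If [C] is not separated, the ideal itself is linearly presented
    ([not_separated_betti]).  The vertices of the graph at [L] attached to one
    circuit form a clique, and the cliques of two circuits meet unless [L] is
    the squarefree monomial of their union; in that last case non-separation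
    provides intermediate circuits.

    Finally, list the circuits inside the union of separated [u] and [v].  If
    [v \ u] has three elements, these are two disjoint triples, the complement
    of [clutter_B'].  If it has two, they are [u] and one, two or three triples
    containing [v \ u], the complements of [clutter_B2], [clutter_B1] and
    [clutter_B].  So being separated is exactly containing a forbidden clutter
    in the complement ([clutter_freeP]). *)

Set Implicit Arguments.
Unset Strict Implicit.
Unset Printing Implicit Defensive.

Import Order.TTheory GRing.Theory Num.Theory.

Local Open Scope ring_scope.

(** * The index and the vanishing of Betti numbers *)

(** The supremum in the extended integers is attained on a nonempty bounded
    set of naturals and is [+oo] on an unbounded one; as [step_linear] is inherited by
    smaller step numbers, only the step number 1 matters. *)
Lemma GL_index_gt1 (K : fieldType) (n : nat) (I : set {mpoly K[n]}) :
  (EFin 1%R < GL_index I)%O <-> step_linear I 1.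
Proof.
rewrite /GL_index.
set A := (X in supremum _ X).
have mono r : step_linear I r -> (1 <= r)%N -> step_linear I 1.
  move=> [d [gd b0]] r1; exists d; split=> // i j i1 ij.
  by apply: b0 => //; apply: leq_trans r1.
split=> [|h].
- apply: contraPP => h1.
  have ub : ubound A (EFin 0).
    move=> _ [[|r] hr <-]; first by rewrite lee_fin.
    by case: h1; apply: mono hr _.
  have : (supremum (ENInf int) A <= EFin 0)%O.
    rewrite /supremum; case: ifP => // _.
    by case: xgetP => // x -> [_]; apply.
  by case: (supremum _ _) => [x| |] //; rewrite /adde !(lee_fin, lte_fin) => ?; lia.
- have leabs (r : nat) (x : int) : r%:Z <= x -> (r <= `|x|)%N by lia.
  have A1 : A (EFin 1%:Z) by exists 1%N.
  have nz : (supremums A !=set0)%classic.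
    have [[b hb]|hb] := pselect (exists b : nat,
        forall r, step_linear I r -> (r <= b)%N).
      have ubb : (ubound [set r | step_linear I r] !=set0)%classic.
        by exists b => r /hb; rewrite leEnat.
      have [s [us ls]] := nat_supremums_neq0 ubb.
      exists (EFin s%:Z); split.
        by move=> _ [r hr <-]; rewrite lee_fin lez_nat; apply: us.
      case=> [x| |] ux //; last by have := ux _ A1.
      rewrite lee_fin.
      have x0 : 0 <= x by have := ux _ A1; rewrite lee_fin; lia.
      rewrite -(gez0_abs x0) lez_nat; apply: ls => r hr.
      have : (EFin r%:Z <= EFin x)%O by apply: ux; exists r.
      by rewrite lee_fin leEnat; apply: leabs.
    exists (EPInf int); split=> [x _|]; first exact: leey.
    case=> [x| |] ux //; last by have := ux _ A1.
    case: hb; exists `|x|%N => r hr.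
    have : (EFin r%:Z <= EFin x)%O by apply: ux; exists r.
    by rewrite lee_fin; apply: leabs.
  have := ge_supremum_Nmem (ENInf int) nz A1.
  by case: (supremum _ _) => [x| |] //; rewrite /adde !(lee_fin, lte_fin) => ?; lia.
Qed.

Lemma dim_mod_eq0 (K : fieldType) (V : lmodType K) (Z B : set V) :
  dim_mod Z B = EFin 0%N <-> (Z `<=` B)%classic.
Proof.
rewrite /dim_mod; case: xgetP => [x -> [m [f [[fZ ff fs] ->]]]|none]; split=> //.
- case=> m0; subst m => z /fs[c]; by rewrite big_ord0 subr0.
- move=> ZB; congr EFin; case: m f fZ ff fs => // m f fZ ff _.
  have /ff/(_ ord0) : B (\sum_i (i == ord0)%:R *: f i).
    rewrite (bigD1 ord0) //= scale1r big1 ?addr0; first exact/ZB.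
    by move=> i /negbTE ->; rewrite scale0r.
  by move/eqP; rewrite eqxx oner_eq0.
- move=> ZB; case: (none (EFin 0%N)); exists 0%N, (fun _ => 0); split=> //.
  split=> [[]|c _ []|z Zz] //; exists (fun _ => 0).
  by rewrite big_ord0 subr0; apply: ZB.
Qed.

(** * Monomial ideals *)

(** Only upward closed [M] are of interest: then this is the ideal spanned by
    the monomials in [M]. *)
Definition monideal (K : fieldType) (n : nat) (M : set 'X_{1..n}) :
    set {mpoly K[n]} :=
  [set p | forall m, m \in msupp p -> M m]%classic.

Arguments monideal K {n} M.

Section MonomialIdeals.
Context (K : fieldType) (n : nat).
Implicit Types (M : set 'X_{1..n}) (p q : {mpoly K[n]}).

Lemma monidealX M m : M m -> monideal K M 'X_[m].
Proof. by move=> Mm m'; rewrite msuppX inE => /eqP ->. Qed.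

Lemma monideal0 M : monideal K M 0.
Proof. by move=> m; rewrite msupp0. Qed.

Lemma monidealD M p q : monideal K M p -> monideal K M q -> monideal K M (p + q).
Proof.
move=> Mp Mq m /msuppD_le; rewrite mem_cat => /orP[]; [exact: Mp|exact: Mq].
Qed.

Lemma monidealZ M (c : K) p : monideal K M p -> monideal K M (c *: p).
Proof. by move=> Mp m /msuppZ_le /Mp. Qed.

Lemma monideal_sum M (I : Type) (r : seq I) (P : pred I) F :
  (forall i, P i -> monideal K M (F i)) ->
  monideal K M (\sum_(i <- r | P i) F i).
Proof.
by move=> MF; elim/big_ind: _ => //; [exact: monideal0|exact: monidealD].
Qed.

Lemma monidealM M N L p q :
  (forall a b, M a -> N b -> L (a + b)%MM) ->
  monideal K M p -> monideal K N q -> monideal K L (p * q).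
Proof.
move=> MNL Mp Nq m /msuppM_le /allpairsP[[a b] /= [/Mp Ma /Nq Nb ->]].
exact: MNL.
Qed.

End MonomialIdeals.

Section IdealGen.
Context (R : comNzRingType).
Implicit Types (G : set R).

Lemma ideal_gen_mem G a g : G g -> ideal_gen G (a * g).
Proof.
by move=> Gg; exists 1%N, (fun _ => a), (fun _ => g); rewrite big_ord1.
Qed.

Lemma ideal_gen0 G : ideal_gen G 0.
Proof.
by exists 0%N, (fun _ => 0), (fun _ => 0); split=> [[]//|]; rewrite big_ord0.
Qed.

Lemma ideal_genD G x y : ideal_gen G x -> ideal_gen G y -> ideal_gen G (x + y).
Proof.
move=> [m [a [g [Gg ->]]]] [m' [a' [g' [Gg' ->]]]].
pose glue T (u : 'I_m -> T) u' (i : 'I_(m + m')) :=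
  match split i with inl j => u j | inr j => u' j end.
exists (m + m')%N, (glue _ a a'), (glue _ g g'); split.
  by move=> i; rewrite /glue; case: split.
rewrite big_split_ord /glue; congr (_ + _); apply: eq_bigr => i _.
  by case: splitP => j /= ij; [rewrite (ord_inj ij)|have := ltn_ord i; lia].
by case: splitP => j /= ij; [have := ltn_ord j; lia|rewrite (ord_inj (addnI ij))].
Qed.

Lemma ideal_gen_sum G (I : Type) (r : seq I) (P : pred I) F :
  (forall i, P i -> ideal_gen G (F i)) -> ideal_gen G (\sum_(i <- r | P i) F i).
Proof.
by move=> GF; elim/big_ind: _ => //; [exact: ideal_gen0|exact: ideal_genD].
Qed.

End IdealGen.

(** The monomials of the [k]-th power of an edge ideal: the upward closed set
    generated by the products of [k] circuits. *)
Definition circuit_mon (n : nat) (C : {set {set 'I_n}}) (k : nat) :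
    set 'X_{1..n} :=
  [set m | exists s : seq {set 'I_n},
     [/\ {subset s <= C}, size s = k & (\sum_(F <- s) mesym1 F <= m)%MM]]%classic.

Section EdgeIdealPowers.
Context (K : fieldType) (n : nat).
Implicit Types (C : {set {set 'I_n}}).

Lemma circuit_mon_up C k m m' :
  circuit_mon C k m -> (m <= m')%MM -> circuit_mon C k m'.
Proof. by move=> [s [sC sk sm]] mm'; exists s; split=> //; apply: lepm_trans mm'. Qed.

Lemma mprod_mesym1 (F : {set 'I_n}) :
  \prod_(v in F) 'X_v = 'X_[mesym1 F] :> {mpoly K[n]}.
Proof.
rewrite mprodXE; congr 'X_[_]; apply/mnmP => i.
rewrite mnm_sumE mnmE; under eq_bigr => j _ do rewrite mnm1E.
case: (boolP (i \in F)) => iF; last first.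
  by rewrite big1 // => j jF; case: eqVneq => // ji; rewrite -ji jF in iF.
by rewrite (bigD1 i) //= eqxx big1 // => j /andP[_ /negbTE ->].
Qed.

Lemma mdeg_sum_mesym1 C (s : seq {set 'I_n}) (d : nat) :
  (forall F, F \in C -> #|F| = d) -> {subset s <= C} ->
  mdeg (\sum_(F <- s) mesym1 F) = (size s * d)%N.
Proof.
move=> Cd; elim: s => [|F s IHs] sC; first by rewrite big_nil mdeg0.
rewrite big_cons mdegD mdeg_mesym1 Cd ?sC ?mem_head // IHs ?mulSn //.
by move=> G Gs; rewrite sC // inE Gs orbT.
Qed.

Lemma edge_ideal_exp C k :
  ideal_exp (edge_ideal K C) k = monideal K (circuit_mon C k).
Proof.
elim: k => [|k IHk].
  apply/seteqP; split=> // p _ m _; exists [::]; split=> //.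
  by rewrite big_nil; apply/mnm_lepP => i; rewrite mnmE.
rewrite /ideal_exp iterS -/(ideal_exp _ k) IHk; apply/seteqP; split=> p.
  move=> [m [a [g [Gg ->]]]]; apply: monideal_sum => i _.
  have [x [y [[m' [b [h [Gh ->]]]] My ->]]] := Gg i.
  rewrite mulr_suml mulr_sumr; apply: monideal_sum => j _.
  have [F FC ->] := Gh j; rewrite mprod_mesym1.
  have -> : a i * (b j * 'X_[mesym1 F] * y) = (a i * b j) * ('X_[mesym1 F] * y).
    by rewrite !mulrA.
  apply: (@monidealM _ _ setT (circuit_mon C k.+1)) => [u v _ Mv|//|].
    by apply: circuit_mon_up Mv (lem_addl _ _).
  apply: (@monidealM _ _ [set mesym1 F]%classic (circuit_mon C k)) => //.
    move=> _ v -> [s [sC sk sv]]; exists (F :: s); split.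
    - by move=> G; rewrite inE => /orP[/eqP->//|/sC].
    - by rewrite /= sk.
    - rewrite big_cons; apply/mnm_lepP => i'; rewrite !mnmDE leq_add2l.
      exact/mnm_lepP.
  exact: monidealX.
move=> Mp; rewrite [p]mpolyE big_seq; apply: ideal_gen_sum => m mp.
have [s0 [sC sk sm]] := Mp m mp; case: s0 sC sk sm => [//|F s] sC [sk] sm.
have -> : p@_m *: 'X_[m] =
    (p@_m *: 'X_[m - \sum_(G <- F :: s) mesym1 G]) *
    ('X_[mesym1 F] * 'X_[\sum_(G <- s) mesym1 G]).
  by rewrite -mpolyXD -scalerAl -mpolyXD -(big_cons _ _ F s xpredT) submK.
apply: ideal_gen_mem; exists 'X_[mesym1 F], 'X_[\sum_(G <- s) mesym1 G]; split=> //.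
  rewrite -mprod_mesym1 -[X in edge_ideal _ _ X]mul1r; apply: ideal_gen_mem.
  by exists F => //; apply: sC; rewrite mem_head.
apply: monidealX; exists s; split=> //; last exact: lepm_refl.
by move=> G Gs; apply: sC; rewrite inE Gs orbT.
Qed.

Lemma circuit_mon_generated C k d : (forall F, F \in C -> #|F| = d) ->
  generated_in_degree (monideal K (circuit_mon C k)) (k * d).
Proof.
move=> Cd; apply/seteqP; split=> p; last first.
  move=> [m [a [g [Gg ->]]]]; apply: monideal_sum => i _.
  apply: (@monidealM _ _ setT (circuit_mon C k)) (Gg i).1 => // u v _ Mv.
  by apply: circuit_mon_up Mv (lem_addl _ _).
move=> Mp; rewrite [p]mpolyE big_seq; apply: ideal_gen_sum => m mp.
have [s [sC sk sm]] := Mp m mp.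
rewrite -(submK sm) mpolyXD scalerAl; apply: ideal_gen_mem; split.
  by apply: monidealX; exists s; split=> //; apply: lepm_refl.
by rewrite dhomogX /= (mdeg_sum_mesym1 Cd) // sk.
Qed.

(** Multiplication by polynomials only raises degrees; this bounds the
    generating degree, which [step_linear] leaves existentially quantified. *)
Lemma generated_in_degree_le (M : set 'X_{1..n}) d m :
  generated_in_degree (monideal K M) d -> M m -> (d <= mdeg m)%N.
Proof.
move=> gd /(@monidealX K); rewrite gd => -[r [a [g [Gg e]]]].
rewrite leqNgt; apply/negP => dm.
suff /eqP : ('X_[m] : {mpoly K[n]})@_m = 0 by rewrite mcoeffX eqxx oner_eq0.
rewrite e raddf_sum big1 // => i _; apply/eqP; rewrite mcoeff_eq0.
apply: contraL dm => /msuppM_le /allpairsP[[u v] /= [_ vg ->]].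
by rewrite -leqNgt mdegD -(dhomog_mf (Gg i).2 vg) leq_addl.
Qed.

End EdgeIdealPowers.

(** * Koszul homology of monomial ideals in low degrees *)

Section Koszul.
Context (K : fieldType) (n : nat).
Local Notation S := {mpoly K[n]}.
Implicit Types (M : set 'X_{1..n}) (p : S).

Local Notation d := (free_map (@koszul_diff K n _)).

Lemma free_mapD (A B : finType) (T : A -> B -> S) (u v : {ffun A -> S}) :
  free_map T (u + v) = free_map T u + free_map T v.
Proof.
apply/ffunP => b; rewrite !ffunE -big_split; apply: eq_bigr => a _.
by rewrite ffunE mulrDl.
Qed.

Lemma free_mapZ (A B : finType) (T : A -> B -> S) (c : K) (v : {ffun A -> S}) :
  free_map T (c *: v) = c *: free_map T v.
Proof.
apply/ffunP => b; rewrite !ffunE scaler_sumr.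
by apply: eq_bigr => a _; rewrite ffunE scalerAl.
Qed.

Definition single (A : finType) (a : A) p : {ffun A -> S} :=
  [ffun b => p *+ (b == a)].

Lemma single_sum (A : finType) (v : {ffun A -> S}) : v = \sum_a single a (v a).
Proof.
apply/ffunP => b; rewrite sum_ffunE (bigD1 b) //= ffunE eqxx mulr1n.
by rewrite big1 ?addr0 // => a /negbTE ab; rewrite ffunE eq_sym ab.
Qed.

Lemma single_suml (A : finType) (a : A) (I : Type) (r : seq I) (P : pred I) F :
  single a (\sum_(i <- r | P i) F i) = \sum_(i <- r | P i) single a (F i).
Proof.
apply/ffunP => b; rewrite sum_ffunE ffunE -sumrMnl.
by apply: eq_bigr => i _; rewrite ffunE.
Qed.

Lemma singleZ (A : finType) (a : A) (c : K) p : single a (c *: p) = c *: single a p.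
Proof. by apply/ffunP => b; rewrite !ffunE scalerMnr. Qed.

Lemma free_map_single (A B : finType) (T : A -> B -> S) a p :
  free_map T (single a p) = [ffun b => p * T a b].
Proof.
apply/ffunP => b; rewrite !ffunE (bigD1 a) //= ffunE eqxx mulr1n big1 ?addr0 //.
by move=> a' /negbTE aa'; rewrite ffunE aa' mulr0n mul0r.
Qed.

Fact kempty_subproof : #|finset.set0 : {set 'I_n}| == 0%N.
Proof. by rewrite cards0. Qed.
Definition kempty : koszul_basis n 0 := Sub finset.set0 kempty_subproof.

Fact kpoint_subproof (t : 'I_n) : #|[set t]%SET| == 1%N.
Proof. by rewrite cards1. Qed.
Definition kpoint (t : 'I_n) : koszul_basis n 1 := Sub [set t]%SET (kpoint_subproof t).

Lemma kemptyP (b : koszul_basis n 0) : b = kempty.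
Proof. by apply/val_inj/eqP; rewrite /= -cards_eq0 (valP b). Qed.

Lemma kpointP (b : koszul_basis n 1) : exists t, b = kpoint t.
Proof. by have /cards1P[t bt] := valP b; exists t; apply/val_inj. Qed.

Lemma kpoint_inj : injective kpoint.
Proof. by move=> t u /(congr1 val) /= /finset.set1_inj. Qed.

Lemma kedgeP (a : koszul_basis n 2) :
  exists k l : 'I_n, (k < l)%N /\ val a = [set k; l]%SET.
Proof.
have /cards2P[k [l [kl ->]]] := valP a.
case: (ltngtP k l) => [lt|gt|e]; first by exists k, l.
  by exists l, k; rewrite finset.setUC.
by rewrite (ord_inj e) eqxx in kl.
Qed.

Lemma sum_kpoint (V : zmodType) (F : koszul_basis n 1 -> V) :
  \sum_b F b = \sum_t F (kpoint t).
Proof.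
rewrite (reindex kpoint) //=.
pose g (b : koszul_basis n 1) := sval (cid (kpointP b)).
have gP b : b = kpoint (g b) by exact: (svalP (cid (kpointP b))).
exists g => b _; last by rewrite -gP.
by apply: kpoint_inj; rewrite -gP.
Qed.

Lemma koszul_coef1 (t : 'I_n) : koszul_coef K [set t]%SET finset.set0 = 'X_t.
Proof.
rewrite /koszul_coef (big_pred1 t) => [|k].
  rewrite (_ : [set _ in _ | _]%SET = finset.set0) ?cards0 ?mul1r //.
  by apply/setP => l; rewrite !inE; case: eqVneq => // ->; rewrite ltnn.
rewrite !inE; case: eqVneq => //= ->.
by apply/eqP/setP => l; rewrite !inE andNb.
Qed.

(** Deleting [k], the smaller vertex, has sign [+] and leaves [l]; deleting [l]
    has sign [-] and leaves [k]. *)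
Lemma koszul_coef2 (k l t : 'I_n) : (k < l)%N ->
  koszul_coef K [set k; l]%SET [set t]%SET =
  'X_k *+ (t == l) - 'X_l *+ (t == k).
Proof.
move=> kl.
have nkl : k != l by apply: contraTneq kl => ->; rewrite ltnn.
rewrite /koszul_coef big_mkcondr big_setU1 ?inE //= big_set1.
rewrite setU1K ?inE // finset.setUC setU1K ?inE 1?eq_sym // finset.setUC.
rewrite !(inj_eq finset.set1_inj) ![t == _]eq_sym.
have -> : [set x in [set k; l] | (x < k)%N]%SET = finset.set0.
  apply/setP => x; rewrite !inE; case: eqVneq => [->|_]; rewrite ?ltnn //=.
  by case: eqVneq => // ->; rewrite ltnNge (ltnW kl).
have -> : [set x in [set k; l] | (x < l)%N]%SET = [set k]%SET.
  apply/setP => x; rewrite !inE; case: eqVneq => [->|_] //=.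
  by case: eqVneq => // ->; rewrite ltnn.
rewrite cards0 cards1 expr0 expr1 mul1r mulN1r.
by case: (l == t); case: (k == t); rewrite ?mulr1n ?mulr0n ?oppr0.
Qed.

Lemma koszul_diff0 (z : {ffun koszul_basis n 1 -> S}) b :
  d z b = \sum_t z (kpoint t) * 'X_t.
Proof.
rewrite ffunE sum_kpoint; apply: eq_bigr => t _.
by rewrite (kemptyP b) /koszul_diff koszul_coef1.
Qed.

Lemma koszul_diff1 (a : koszul_basis n 2) (k l : 'I_n) p :
  (k < l)%N -> val a = [set k; l]%SET ->
  d (single a p) = single (kpoint l) (p * 'X_k) - single (kpoint k) (p * 'X_l).
Proof.
move=> kl ae; apply/ffunP => b; have [t ->] := kpointP b.
rewrite free_map_single !ffunE /koszul_diff ae koszul_coef2 //.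
by rewrite !(inj_eq kpoint_inj) mulrBr !mulrnAr.
Qed.

Local Notation chains M i j :=
  (@tor_chains K n (koszul_resolution K n) (monideal K M) i j).
Local Notation cycles M i j :=
  (@tor_cycles K n (koszul_resolution K n) (monideal K M) i j).
Local Notation boundaries M i j :=
  (@tor_boundaries K n (koszul_resolution K n) (monideal K M) i j).

Lemma shift_homogX j i m : (mdeg m + i)%N = j ->
  shift_homog j i ('X_[m] : S).
Proof. by move=> <-; rewrite /shift_homog leq_addl addnK /= dhomogX /=. Qed.

Lemma shift_homog_mdeg j i p m :
  shift_homog j i p -> m \in msupp p -> (mdeg m + i)%N = j.
Proof.
rewrite /shift_homog /=; case: ifP => ij; last by move/eqP->; rewrite msupp0.
by move=> /dhomog_mf hp /hp /= ->; rewrite subnK.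
Qed.

Lemma shift_homog0 j i : shift_homog j i (0 : S).
Proof. by rewrite /shift_homog /= eqxx; case: ifP => // _; apply: dhomog0. Qed.

Lemma single_chain M i j (a : koszul_basis n i) m :
  M m -> (mdeg m + i)%N = j -> chains M i j (single a 'X_[m]).
Proof.
move=> Mm mj b; rewrite ffunE; case: eqVneq => _.
  by split; [apply: monidealX|apply: shift_homogX].
by split; [apply: monideal0|apply: shift_homog0].
Qed.

Lemma shift_homogD j i p q :
  shift_homog j i p -> shift_homog j i q -> shift_homog j i (p + q).
Proof.
rewrite /shift_homog /=; case: ifP => _; first exact: rpredD.
by move=> /eqP-> /eqP->; rewrite addr0.
Qed.

Lemma shift_homogZ j i (c : K) p : shift_homog j i p -> shift_homog j i (c *: p).
Proof.
rewrite /shift_homog /=; case: ifP => _; first exact: rpredZ.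
by move=> /eqP->; rewrite scaler0.
Qed.

Lemma boundary0 M i j : boundaries M i j 0.
Proof.
exists 0; last by apply/ffunP => b; rewrite !ffunE big1 // => a _; rewrite ffunE mul0r.
by move=> b; rewrite ffunE; split; [exact: monideal0|exact: shift_homog0].
Qed.

Lemma boundaryD M i j (y z : {ffun koszul_basis n i -> S}) :
  boundaries M i j y -> boundaries M i j z -> boundaries M i j (y + z).
Proof.
move=> [u cu <-] [v cv <-]; exists (u + v); last exact: free_mapD.
move=> b; rewrite ffunE; have [? ?] := cu b; have [? ?] := cv b.
by split; [apply: monidealD|apply: shift_homogD].
Qed.

Lemma boundary_sum M i j (I : Type) (r : seq I) (P : pred I)
    (F : I -> {ffun koszul_basis n i -> S}) :
  (forall x, P x -> boundaries M i j (F x)) ->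
  boundaries M i j (\sum_(x <- r | P x) F x).
Proof.
by move=> BF; elim/big_ind: _ => //; [exact: boundary0|exact: boundaryD].
Qed.

Lemma boundaryZ M i j (c : K) (z : {ffun koszul_basis n i -> S}) :
  boundaries M i j z -> boundaries M i j (c *: z).
Proof.
move=> [x cx <-]; exists (c *: x); last by rewrite free_mapZ.
move=> b; rewrite ffunE; have [? ?] := cx b.
by split; [apply: monidealZ|apply: shift_homogZ].
Qed.

(** A monomial [m] which stays in the ideal after division by [x_k] is the
    boundary of [m / x_k] placed at the vertex [k]. *)
Lemma betti0_eq0 M j :
  (forall m, M m -> mdeg m = j -> exists2 k, (0 < m k)%N & M (m - U_(k))%MM) ->
  betti (monideal K M) 0 j = EFin 0%N.
Proof.
move=> Mj; apply/dim_mod_eq0 => z /(_ kempty)[Mz hz].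
have -> : z = \sum_(m <- msupp (z kempty)) (z kempty)@_m *: single kempty 'X_[m].
  rewrite {1}[z]single_sum (big_pred1 kempty); last first.
    by move=> b; rewrite (kemptyP b) /= eqxx.
  rewrite [X in single _ X]mpolyE single_suml.
  by apply: eq_bigr => m _; rewrite singleZ.
rewrite big_seq; apply: boundary_sum => m mz; apply: boundaryZ.
have mj : mdeg m = j by rewrite -(shift_homog_mdeg hz mz) addn0.
have [k mk Mk] := Mj m (Mz _ mz) mj.
have um : (U_(k) <= m)%MM.
  by apply/mnm_lepP => i; rewrite mnm1E; case: eqVneq => // <-.
exists (single (kpoint k) 'X_[m - U_(k)]).
  apply: single_chain => //.
  by rewrite -mj -[in RHS](submK um) mdegD mdeg1.
rewrite free_map_single; apply/ffunP => b; rewrite !ffunE (kemptyP b) eqxx mulr1n.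
rewrite [res_diff _ _](_ : _ = 'X_k); last exact: koszul_coef1.
by rewrite -mpolyXD submK.
Qed.

(** With [koszul_graph], the 1-skeleton of the upper Koszul simplicial complex of the
    ideal at [L]; its reduced zeroth homology is the degree [L] part of Tor_1. *)
Definition koszul_vertex M (L : 'X_{1..n}) (k : 'I_n) : Prop :=
  (0 < L k)%N /\ M (L - U_(k))%MM.

Definition koszul_graph M (L : 'X_{1..n}) : rel 'I_n := fun k l =>
  [&& k != l, (0 < L k)%N, (0 < L l)%N & `[< M (L - U_(k) - U_(l))%MM >]].

Lemma koszul_graph_sym M L : ssrbool.symmetric (koszul_graph M L).
Proof.
move=> k l; rewrite /koszul_graph eq_sym; congr (_ && _).
by rewrite andbCA !submDA [(U_(k) + _)%MM]addmC.
Qed.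

Let mon_le1 (L : 'X_{1..n}) k : (0 < L k)%N -> (U_(k) <= L)%MM.
Proof. by move=> Lk; apply/mnm_lepP => i; rewrite mnm1E; case: eqVneq => // <-. Qed.

Lemma mcoeffMXU p (k : 'I_n) L :
  (p * 'X_k)@_L = if (0 < L k)%N then p@_(L - U_(k)) else 0.
Proof.
case: ifPn => Lk; first by rewrite -{1}(submK (mon_le1 Lk)) addmC mcoeffMX.
apply: memN_msupp_eq0; rewrite (perm_mem (msuppMX _ _)).
by apply: contra Lk => /mapP[m _ ->]; rewrite mnmDE mnm1E eqxx.
Qed.

Definition vertex_chain (L : 'X_{1..n}) (k : 'I_n) : {ffun koszul_basis n 1 -> S} :=
  single (kpoint k) 'X_[L - U_(k)].

Lemma koszul_graph_boundary M L k l : koszul_graph M L k l ->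
  boundaries M 1 (mdeg L) (vertex_chain L k - vertex_chain L l).
Proof.
wlog kl : k l / (k < l)%N.
  move=> wl; case: (ltngtP k l) => [kl|lk|/ord_inj ->]; first exact: wl.
    rewrite koszul_graph_sym => /(wl _ _ lk) b; rewrite -opprB -scaleN1r.
    exact: boundaryZ.
  by rewrite /koszul_graph eqxx.
case/and4P=> nkl Lk Ll /asboolP Mkl.
have sk : #|[set k; l]%SET| == 2 by rewrite cards2 nkl.
have Llk : (U_(k) <= L - U_(l))%MM.
  by apply: mon_le1; rewrite mnmBE mnm1E eq_sym (negbTE nkl) subn0.
have Lkl : (U_(l) <= L - U_(k))%MM.
  by apply: mon_le1; rewrite mnmBE mnm1E (negbTE nkl) subn0.
rewrite -opprB -scaleN1r; apply: boundaryZ.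
pose a : koszul_basis n 2 := Sub [set k; l]%SET sk.
have ae : val a = [set k; l]%SET by [].
exists (single a 'X_[L - U_(k) - U_(l)]).
  apply: single_chain => //.
  rewrite -[in RHS](submK (mon_le1 Lk)) -(submK Lkl) !mdegD !mdeg1.
  by rewrite (submK Lkl) -addnA.
apply: etrans (koszul_diff1 _ kl ae) _; rewrite -!mpolyXD.
by rewrite {1}submDA [(U_(k) + _)%MM]addmC -submDA !submK.
Qed.

Lemma connect_boundary M L k l : connect (koszul_graph M L) k l ->
  boundaries M 1 (mdeg L) (vertex_chain L k - vertex_chain L l).
Proof.
case/connectP => p; elim: p k => [|i p IHp] k /= => [_ ->|/andP[ki ip] li].
  by rewrite subrr; apply: boundary0.
rewrite -(subrKA (vertex_chain L i)); apply: boundaryD; last exact: IHp.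
exact: koszul_graph_boundary.
Qed.

(** Split a cycle along monomials [L].  At [L] it is a combination of vertices
    with coefficients of sum 0, hence a combination of differences of vertices,
    and the difference of two connected vertices is a boundary. *)
Lemma betti1_eq0 M j :
  (forall L, mdeg L = j -> forall k l, koszul_vertex M L k -> koszul_vertex M L l ->
     connect (koszul_graph M L) k l) ->
  betti (monideal K M) 1 j = EFin 0%N.
Proof.
move=> con; apply/dim_mod_eq0 => z [cz dz].
pose b := (\max_t msize (z (kpoint t) * 'X_t))%N.
pose c L t := (z (kpoint t) * 'X_t)@_L.
have cP L t : c L t != 0 -> koszul_vertex M L t /\ mdeg L = j.
  rewrite /c mcoeffMXU; case: ifP => [Lt|]; last by rewrite eqxx.
  rewrite mcoeff_eq0 negbK => zL; have [Mz hz] := cz (kpoint t).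
  split; first by split=> //; apply: Mz.
  by rewrite -(shift_homog_mdeg hz zL) -[in LHS](submK (mon_le1 Lt)) mdegD mdeg1.
have c0 L : \sum_t c L t = 0.
  have := congr1 (fun v : {ffun koszul_basis n 0 -> S} => (v kempty)@_L) dz.
  by rewrite koszul_diff0 ffunE mcoeff0 raddf_sum.
have -> : z = \sum_(L : 'X_{1..n < b}) \sum_t c L t *: vertex_chain L t.
  rewrite [LHS]single_sum sum_kpoint exchange_big; apply: eq_bigr => t _ /=.
  under [RHS]eq_bigr => L _ do rewrite -singleZ.
  rewrite -single_suml; congr single.
  have Xt : ('X_t : S) != 0 by rewrite -msupp_eq0 msuppX.
  apply: (mulIf Xt); rewrite mulr_suml.
  rewrite [LHS](@mpolywE _ _ b); last exact: (leq_bigmax t).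
  apply: eq_bigr => L _; rewrite -/(c L t).
  have [->|cLt] := eqVneq (c L t) 0; first by rewrite !scale0r mul0r.
  by rewrite -scalerAl -mpolyXD submK // mon_le1 // (cP _ _ cLt).1.1.
apply: boundary_sum => L _.
have [r cr|cL] := pickP (fun t => c L t != 0); last first.
  apply: boundary_sum => t _; have /negbFE/eqP -> := cL t.
  by rewrite scale0r; apply: boundary0.
have -> : \sum_t c L t *: vertex_chain L t =
    \sum_t c L t *: (vertex_chain L t - vertex_chain L r).
  have e0 : \sum_t c L t *: vertex_chain L r = 0 by rewrite -scaler_suml c0 scale0r.
  rewrite -[LHS]subr0 -[X in _ - X]e0 -sumrB.
  by apply: eq_bigr => t _; rewrite scalerBr.
apply: boundary_sum => t _; have [->|ct] := eqVneq (c L t) 0.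
  by rewrite scale0r; apply: boundary0.
have [vr Lj] := cP _ _ cr; have [vt _] := cP _ _ ct.
by apply: boundaryZ; rewrite -Lj; apply: connect_boundary; apply: con.
Qed.

(** A union [P] of components, containing the vertex [k0] but not [l0], gives a
    linear form on 1-chains, the sum over [P] of the coefficients at [L].  It
    vanishes on boundaries because an edge has both ends or none in [P], and
    takes the value 1 on the cycle [k0 - l0]. *)
Lemma betti1_neq0 M L (P : {set 'I_n}) k0 l0 :
  koszul_vertex M L k0 -> koszul_vertex M L l0 -> k0 \in P -> l0 \notin P ->
  (forall k l, koszul_graph M L k l -> k \in P -> l \in P) ->
  betti (monideal K M) 1 (mdeg L) <> EFin 0%N.
Proof.
move=> [Lp Mp] [Lq Mq] pP qP closed /dim_mod_eq0 sub.
pose f (z : {ffun koszul_basis n 1 -> S}) : K :=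
  \sum_(t in P) (z (kpoint t) * 'X_t)@_L.
have fD x y : f (x + y) = f x + f y.
  by rewrite /f -big_split; apply: eq_bigr => t _; rewrite ffunE mulrDl mcoeffD.
have f_single t r : f (single (kpoint t) r) = (r * 'X_t)@_L *+ (t \in P).
  case: (boolP (t \in P)) => tP; last first.
    rewrite /f big1 // => u uP; rewrite ffunE (inj_eq kpoint_inj).
    by case: eqVneq uP => [->|_ _]; rewrite ?(negbTE tP) // mul0r mcoeff0.
  rewrite /f (bigD1 t) //= ffunE eqxx mulr1n big1 ?addr0 // => u /andP[_ ut].
  by rewrite ffunE (inj_eq kpoint_inj) (negbTE ut) mul0r mcoeff0.
have fN x : f (- x) = - f x.
  by rewrite /f -sumrN; apply: eq_bigr => t _; rewrite ffunE mulNr mcoeffN.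
have vchain t : koszul_vertex M L t -> chains M 1 (mdeg L) (vertex_chain L t).
  move=> [Lt Mt]; apply: single_chain => //.
  by rewrite -[in RHS](submK (mon_le1 Lt)) mdegD mdeg1.
have vdiff t : koszul_vertex M L t -> d (vertex_chain L t) = [ffun=> 'X_[L]].
  move=> [Lt _]; apply/ffunP => b; rewrite koszul_diff0 ffunE (bigD1 t) //= ffunE eqxx mulr1n.
  rewrite -mpolyXD submK ?mon_le1 // big1 ?addr0 // => u /negbTE ut.
  by rewrite ffunE (inj_eq kpoint_inj) ut mulr0n mul0r.
(* the cycle [k0 - l0] *)
pose z := vertex_chain L k0 - vertex_chain L l0.
have fz : f z = 1.
  rewrite /z fD (fN (vertex_chain L l0)) !f_single pP (negbTE qP) mulr0n subr0 mulr1n -mpolyXD.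
  by rewrite submK ?mon_le1 // mcoeffX eqxx.
have zc : cycles M 1 (mdeg L) z.
  split=> [b|].
    have [Ip hp] := vchain k0 (conj Lp Mp) b; have [Iq hq] := vchain l0 (conj Lq Mq) b.
    rewrite /z -scaleN1r; move: (vertex_chain L k0) (vertex_chain L l0) Ip hp Iq hq.
    move=> x y Ix hx Iy hy; rewrite !ffunE.
    split; first exact: monidealD Ix (monidealZ Iy).
    by apply: shift_homogD; [exact: hx|apply: shift_homogZ; exact: hy].
  have dz : d z = 0.
    by rewrite /z -scaleN1r free_mapD free_mapZ !vdiff // scaleN1r subrr.
  exact: dz.
have [w cw dw] := sub z zc.
suff fz0 : f z = 0 by have := oner_neq0 K; rewrite -fz fz0 eqxx.
rewrite -dw [w]single_sum.
have -> : f (d (\sum_a single a (w a))) = \sum_a f (d (single a (w a))).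
  apply: (big_morph (fun v => f (d v))) => [u v|]; first by rewrite free_mapD fD.
  rewrite /f big1 // => t _.
  by rewrite -[0](scale0r (0 : {ffun koszul_basis n 2 -> S})) free_mapZ scale0r ffunE mul0r mcoeff0.
apply: big1 => a _; have [k [l [kl ae]]] := kedgeP a.
rewrite (koszul_diff1 _ kl ae) fD.
rewrite (fN (single (kpoint k) (w a * 'X_l))) !f_single mulrAC.
have [kPlP|kPlP] := eqVneq (k \in P) (l \in P); first by rewrite kPlP subrr.
suff -> : (w a * 'X_l * 'X_k)@_L = 0 by rewrite !mul0rn subrr.
apply: contra_neq_eq kPlP; rewrite !mcoeffMXU.
case: ifP => [Lk|_]; last by rewrite eqxx.
case: ifP => [Ll|_]; last by rewrite eqxx.
rewrite mcoeff_eq0 negbK => /(cw a).1 Mkl.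
have nkl : k != l by apply: contraTneq kl => ->; rewrite ltnn.
have klg : koszul_graph M L k l.
  apply/and4P; split=> //; last exact/asboolP.
  by move: Ll; rewrite mnmBE mnm1E (negbTE nkl) subn0.
by apply/idP/idP; apply: closed; rewrite // koszul_graph_sym.
Qed.

End Koszul.

(** * Separated circuits *)

Section Separated.
Import mathcomp.boot.fintype mathcomp.boot.finset.

(** The hypergraph form of failure of linear presentation: [u] is the only
    circuit in its neighbourhood that avoids a vertex of [v :\: u], so it cannot
    be joined to [v] by changing one variable at a time. *)
Definition separated (T : finType) (C : {set {set T}}) : Prop :=
  exists u v, [/\ u \in C, v \in C, (2 <= #|v :\: u|)%N &
    forall F, F \in C -> F \subset u :|: v -> F = u \/ v :\: u \subset F].

Section Powers.
Context (K : fieldType) (n : nat) (C : {set {set 'I_n}}).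

(** At the monomial [L] below, the vertices in [v :\: u] come from the generator
    [u ^ k.+1], those in [u :\: v] from [u ^ k * v].  An edge leaving [v :\: u]
    would need a generator missing a variable of [v :\: u], hence equal to
    [u ^ k.+1], but also missing one of its [k.+1] copies of a vertex of [u]. *)
Lemma separated_betti d k : (forall F, F \in C -> #|F| = d) -> separated C ->
  exists2 j, (k.+1 * d + 2 <= j)%N &
    betti (monideal K (circuit_mon C k.+1)) 1 j <> EFin 0%N.
Proof.
move=> Cd [u [v [uC vC vu sep]]].
pose L : 'X_{1..n} := (mesym1 u *+ k.+1 + mesym1 (v :\: u))%MM.
have LE i : L i = ((i \in u) * k.+1 + ((i \notin u) && (i \in v)))%N.
  by rewrite /L mnmDE mulmnE !mnmE in_setD.
exists (mdeg L).
  by rewrite mdegD mdegMn !mdeg_mesym1 Cd // mulnC leq_add2l.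
have sum_nseq m i : (\sum_(F <- nseq m u) mesym1 F)%MM i = ((i \in u) * m)%N.
  by rewrite mnm_sumE big_nseq iter_addn addn0 mnmE.
have [p] : exists p, p \in v :\: u.
  by apply/set0Pn; rewrite -card_gt0; apply: leq_trans vu.
have [q] : exists q, q \in u :\: v.
  apply/set0Pn; rewrite -card_gt0; move: vu.
  by rewrite !cardsD (Cd _ uC) (Cd _ vC) setIC; lia.
rewrite !in_setD => /andP[qv qu] /andP[pu pv].
apply: (@betti1_neq0 _ _ _ L (v :\: u) p q).
- split; first by rewrite LE pv pu addn1.
  exists (nseq k.+1 u); split; [|by rewrite size_nseq|].
    by move=> F; rewrite mem_nseq => /andP[_ /eqP ->].
  apply/mnm_lepP => i; rewrite sum_nseq mnmBE mnm1E LE.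
  case: eqVneq => [<-|_]; last by rewrite subn0 leq_addr.
  by rewrite (negbTE pu).
- split; first by rewrite LE qu mul1n.
  exists (v :: nseq k u); split; [|by rewrite /= size_nseq|].
    by move=> F; rewrite inE mem_nseq => /orP[|/andP[_]] /eqP ->.
  apply/mnm_lepP => i; rewrite big_cons mnmDE sum_nseq mnmBE mnm1E LE mnmE.
  case: eqVneq => [<-|_].
    by rewrite qu (negbTE qv) /=; lia.
  by case: (i \in u); case: (i \in v); rewrite /= ?mul1n ?mul0n; clear; lia.
- by rewrite in_setD pu.
- by rewrite in_setD qu.
(* an edge [a b] with [a] in [v :\: u] and [b] outside leads to a contradiction *)
move=> a b /and4P[ab La Lb /asboolP[s [sC sk sm]]] aP; apply: contraT => bP.
move: (aP); rewrite in_setD => /andP[au av].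
(* [a] occurs once in [L], so no circuit of [s] contains it *)
have su : s = nseq k.+1 u.
  rewrite -sk; apply/all_pred1P/allP => F Fs /=; apply/eqP.
  have Fm i : i \in F -> (0 < (L - U_(a) - U_(b))%MM i)%N.
    move=> iF; apply: leq_trans (mnm_lepP sm i).
    by rewrite mnm_sumE (big_rem F) //= mnmE iF.
  have Fuv : F \subset u :|: v.
    apply/subsetP => i /Fm; rewrite !mnmBE LE in_setU.
    by case: (i \in u) => //=; case: (i \in v).
  have [//|] := sep F (sC _ Fs) Fuv.
  move=> /subsetP /(_ a aP) /Fm.
  by rewrite !mnmBE LE (negbTE au) av mnm1E eqxx.
have := mnm_lepP sm b; rewrite su sum_nseq !mnmBE !mnm1E eqxx LE.
rewrite (negbTE ab) subn0.
move: Lb bP; rewrite LE in_setD.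
case: (b \in u) => /=; first by rewrite mul1n addn0 subn1 ltnn.
by case: (b \in v).
Qed.

Lemma circuit_mon1P m :
  circuit_mon C 1 m <-> exists2 F, F \in C & (mesym1 F <= m)%MM.
Proof.
split=> [[s [sC sk sm]]|[F FC Fm]].
  case: s sC sk sm => [|F [|G s]] // sC _ sm.
  exists F; first by apply: sC; rewrite mem_head.
  by move: sm; rewrite big_seq1.
by exists [:: F]; split=> [G|//|]; rewrite ?inE ?big_seq1 // => /eqP ->.
Qed.

(** Each circuit dividing [L] spans a clique, and two cliques meet unless [L] is
    the squarefree monomial of the union of the two circuits. *)
Lemma not_separated_betti j : (forall F, F \in C -> #|F| = 3%N) -> ~ separated C ->
  (4 < j)%N -> betti (monideal K (circuit_mon C 1)) 1 j = EFin 0%N.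
Proof.
move=> C3 nsep j5; apply: betti1_eq0 => L Lj.
(* the clique of [F]: the variables left in [L] after division by [F] *)
pose Z F t := (mesym1 F + U_(t) <= L)%MM.
have ZP F t : Z F t <-> (0 < L t)%N /\ (mesym1 F <= L - U_(t))%MM.
  split=> [ZFt|[Lt FL]]; [split|]; last first.
  - apply/mnm_lepP => i; have := mnm_lepP FL i.
    by rewrite mnmDE mnmBE mnm1E; case: eqVneq => [<-|_]; lia.
  - apply/mnm_lepP => i; have := mnm_lepP ZFt i.
    by rewrite mnmDE mnmBE; lia.
  - by have := mnm_lepP ZFt t; rewrite mnmDE mnm1E eqxx; lia.
have clique F k l : F \in C -> Z F k -> Z F l -> connect (koszul_graph (circuit_mon C 1) L) k l.
  move=> FC Fk Fl; have [->|kl] := eqVneq k l; first exact: connect0.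
  apply: connect1; apply/and4P; split=> //;
    [by have [] := (ZP F k).1 Fk|by have [] := (ZP F l).1 Fl|].
  apply/asboolP/circuit_mon1P; exists F => //; apply/mnm_lepP => i.
  have := mnm_lepP Fk i; have := mnm_lepP Fl i.
  rewrite !mnmBE !mnmDE !mnm1E.
  by case: (eqVneq k i) => [<-|_]; rewrite 1?eq_sym ?(negbTE kl); lia.
pose linked F G := forall k l, Z F k -> Z G l -> connect (koszul_graph (circuit_mon C 1) L) k l.
have slack (W : {set 'I_n}) : (mesym1 W <= L)%MM -> L != mesym1 W ->
    exists t, (mesym1 W + U_(t) <= L)%MM.
  move=> WL nWL; apply/existsP; apply: contraR nWL => /existsPn h.
  apply/eqP/mnmP => i; apply/eqP; rewrite eqn_leq (mnm_lepP WL) andbT leqNgt.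
  apply: contra (h i) => Wi; apply/mnm_lepP => i'; rewrite mnmDE mnm1E.
  by case: eqVneq => [<-|_]; rewrite ?addn1 ?addn0 // (mnm_lepP WL).
have mesym1U F G : (mesym1 F <= L)%MM -> (mesym1 G <= L)%MM -> (mesym1 (F :|: G) <= L)%MM.
  move=> FL GL; apply/mnm_lepP => i; have := mnm_lepP FL i; have := mnm_lepP GL i.
  by rewrite !mnmE in_setU; case: (i \in F); case: (i \in G).
have meet F G : F \in C -> G \in C -> (mesym1 F <= L)%MM -> (mesym1 G <= L)%MM ->
    L != mesym1 (F :|: G) -> linked F G.
  move=> FC GC FL GL /(slack _ (mesym1U _ _ FL GL))[t FGt] k l Fk Gl.
  have [Ft Gt] : Z F t /\ Z G t.
    split; apply/mnm_lepP => i; apply: leq_trans (mnm_lepP FGt i);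
      by rewrite !mnmDE !mnmE in_setU; case: (i \in F); case: (i \in G); rewrite ?leq_addl.
  exact: connect_trans (clique F k t _ _ _) (clique G t l _ _ _).
have trans F G H : G \in C -> (mesym1 G <= L)%MM -> linked F G -> linked G H -> linked F H.
  move=> GC GL FG GH k l Fk Hl; have [|t Gt] := slack G GL.
    by apply: contraTneq j5 => LG; rewrite -Lj LG mdeg_mesym1 C3.
  exact: connect_trans (FG _ _ Fk Gt) (GH _ _ Gt Hl).
have main F G : F \in C -> G \in C -> (mesym1 F <= L)%MM -> (mesym1 G <= L)%MM -> linked F G.
  move=> FC GC FL GL; have [LW|] := eqVneq L (mesym1 (F :|: G)); last exact: meet.
  have subL (H : {set 'I_n}) : H \subset F :|: G -> (mesym1 H <= L)%MM.
    move=> /subsetP HW; rewrite LW; apply/mnm_lepP => i; rewrite !mnmE.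
    by case: (boolP (i \in H)) => // /HW ->.
  have Wj : #|F :|: G| = j by rewrite -mdeg_mesym1 -LW.
  (* non-separation of [F'] from [G'] gives a circuit whose union with [F'] is
     smaller than the union of [F] and [G] *)
  have step F' G' : F' \in C -> G' \in C -> F' :|: G' = F :|: G ->
      exists H, [/\ H \in C, H \subset F :|: G, H != F' & ~~ (G' :\: F' \subset H)].
    move=> F'C G'C eW; apply: contrapT => h; apply: nsep; exists F', G'; split=> //.
      have := cardsUI F' G'; have := cardsID F' G'; rewrite eW Wj (C3 _ F'C) (C3 _ G'C) setIC; lia.
    move=> H HC; rewrite eW => HW; have [->|HF'] := eqVneq H F'; first by left.
    right; apply: contrapT => /negP nH; apply: h; exists H; split=> //.
  have [H [HC HW HF nHG]] := step F G FC GC erefl.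
  have [H' [H'C H'W H'G nH'F]] := step G F GC FC (setUC _ _).
  have FH : linked F H.
    apply: meet => //; first exact: subL.
    rewrite LW; apply: contraNneq nHG => /(@inj_mesym1 n) /setP e.
    apply/subsetP => x; have := e x; rewrite !inE.
    by case: (x \in F); case: (x \in G).
  have H'G' : linked H' G.
    apply: meet => //; first exact: subL.
    rewrite LW; apply: contraNneq nH'F => /(@inj_mesym1 n) /setP e.
    apply/subsetP => x; have := e x; rewrite !inE.
    by case: (x \in F); case: (x \in G); case: (x \in H').
  have [eHG|nLHG] := eqVneq L (mesym1 (H :|: G)); last first.
    exact: (trans _ _ _ HC (subL _ HW) FH (meet _ _ HC GC (subL _ HW) GL nLHG)).
  have [eFH'|nLFH'] := eqVneq L (mesym1 (F :|: H')); last first.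
    exact: (trans _ _ _ H'C (subL _ H'W) (meet _ _ FC H'C FL (subL _ H'W) nLFH') H'G').
  (* only the path [F], [H], [H'], [G] remains: [H] and [H'] both miss the one
     common vertex of [F] and [G] *)
  apply: (trans _ _ _ HC (subL _ HW) FH).
  apply: (trans _ _ _ H'C (subL _ H'W) _ H'G').
  apply: meet => //; [exact: subL|exact: subL|].
  rewrite LW; apply/negP => /eqP/(@inj_mesym1 n)/setP eHH'.
  move: eHG eFH'; rewrite LW => /(@inj_mesym1 n)/setP eHG /(@inj_mesym1 n)/setP eFH'.
  have FH' : ~~ (F \subset H).
    by apply: contra HF => sFH; rewrite eq_sym eqEcard sFH (C3 _ FC) (C3 _ HC).
  have GH' : ~~ (G \subset H').
    by apply: contra H'G => sGH'; rewrite eq_sym eqEcard sGH' (C3 _ GC) (C3 _ H'C).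
  have IFG : (#|F :&: G| <= 1)%N.
    by move: (cardsUI F G) j5; rewrite Wj (C3 _ FC) (C3 _ GC); clear; lia.
  have [x xF xH] := subsetPn FH'; have [y yG yH'] := subsetPn GH'.
  have xG : x \in G.
    by have := eHG x; rewrite !inE xF (negbTE xH).
  have yF : y \in F.
    by have := eFH' y; rewrite !inE yG (negbTE yH') orbT orbF.
  have xy : x = y by apply: (card_le1_eqP IFG); rewrite inE ?xF ?yF.
  by have := eHH' x; rewrite !inE xF (negbTE xH) xy (negbTE yH').
move=> k l [Lk /circuit_mon1P[F FC Fk]] [Ll /circuit_mon1P[G GC Gl]].
have FL := lepm_trans Fk (lem_subr _ _); have GL := lepm_trans Gl (lem_subr _ _).
exact: (main F G FC GC FL GL k l ((ZP F k).2 (conj Lk Fk)) ((ZP G l).2 (conj Ll Gl))).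
Qed.

End Powers.
End Separated.

(** * The four forbidden clutters *)

Section Forbidden.
Import mathcomp.boot.fintype mathcomp.boot.finset.

Definition triples (T : finType) (W : {set T}) : {set {set T}} :=
  [set F : {set T} | (#|F| == 3%N) && (F \subset W)].

Definition missing_triples (T : finType) (D : {set {set T}}) : {set {set T}} :=
  triples (cover D) :\: D.

Lemma imset_inj_in (T U : finType) (f : T -> U) (W : {set T}) :
  {in W &, injective f} ->
  {in powerset W &, injective (fun F : {set T} => f @: F)}.
Proof.
move=> fI F G; rewrite !powersetE => /subsetP FW /subsetP GW e.
apply/setP => x; have [xF|xF] := boolP (x \in F).
  have : f x \in f @: G by rewrite -e imset_f.
  by case/imsetP => y yG /(fI _ _ (FW _ xF) (GW _ yG)) ->.
apply/esym; apply: contraNF xF => xG.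
have : f x \in f @: F by rewrite e imset_f.
by case/imsetP => y yF /(fI _ _ (GW _ xG) (FW _ yF)) ->.
Qed.

Lemma imsetD_in (T U : finType) (g : T -> U) (X A : {set T}) :
  {in X &, injective g} -> A \subset X -> g @: (X :\: A) = g @: X :\: g @: A.
Proof.
move=> gI /subsetP AX; apply/setP => y; apply/imsetP/setDP => [[x]|].
  rewrite in_setD => /andP[xA xX] ->; split; first exact: imset_f.
  by apply: contra xA => /imsetP[x' x'A /(gI _ _ xX (AX _ x'A)) ->].
move=> [/imsetP[x xX ->] yA]; exists x => //; rewrite in_setD xX andbT.
by apply: contra yA => xA; apply: imset_f.
Qed.

Lemma imset_triples (T U : finType) (f : T -> U) (W : {set T}) :
  {in W &, injective f} -> [set f @: F | F : {set T} in triples W] = triples (f @: W).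
Proof.
move=> fI; apply/setP => G; apply/imsetP/idP => [[F]|].
  rewrite !inE => /andP[F3 FW] ->; rewrite imsetS // andbT card_in_imset //.
  by move/subsetP: FW => FW x y /FW xW /FW yW; apply: fI.
rewrite inE => /andP[G3 GW].
have e : G = f @: (W :&: f @^-1: G).
  apply/setP => y; apply/idP/imsetP => [yG|[x]]; last first.
    by rewrite !inE => /andP[_ ?] ->.
  have /imsetP[x xW yx] := subsetP GW _ yG.
  by exists x => //; rewrite !inE xW -yx.
exists (W :&: f @^-1: G) => //; rewrite inE subsetIl andbT -(eqP G3) [in X in _ == X]e.
rewrite card_in_imset // => x y; rewrite !inE => /andP[xW _] /andP[yW _].
exact: fI.
Qed.

(** A bijection from [W] to the vertices of [D] carries triples to triples, so
    it matches complements as soon as it matches the clutters. *)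
Lemma induced_iso_complement (T U : finType) (C : {set {set T}})
    (D : {set {set U}}) (W : {set T}) :
  (forall F, F \in C -> #|F| = 3%N) -> (forall G, G \in D -> #|G| = 3%N) ->
  induced_iso (complement3 C) W D <->
  exists f : T -> U, [/\ {in W &, injective f}, f @: W = cover D
    & [set f @: F | F : {set T} in C ::&: W] = missing_triples D].
Proof.
move=> C3 D3.
have CW : C ::&: W = triples W :\: (complement3 C ::&: W).
  apply/setP => F; rewrite !inE; have [FC|FC] := boolP (F \in C).
    by rewrite (C3 _ FC); case: (F \subset W).
  by case: (F \subset W); rewrite ?andbF //=; case: eqP.
have CW' : complement3 C ::&: W = triples W :\: (C ::&: W).
  by apply/setP => F; rewrite !inE; case: (F \in C); case: (F \subset W);
    rewrite ?andbF ?andbT.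
have Dc : D = triples (cover D) :\: missing_triples D.
  apply/setP => G; rewrite /missing_triples !inE; have [GD|GD] := boolP (G \in D).
    by rewrite (D3 _ GD) eqxx (bigcup_max G).
  by case: (#|G| == 3%N); case: (G \subset _).
have sub1 : C ::&: W \subset triples W by rewrite CW subDset subsetUr.
have sub2 : complement3 C ::&: W \subset triples W by rewrite CW' subDset subsetUr.
have inj f : {in W &, injective f} ->
    {in triples W &, injective (fun F : {set T} => f @: F : {set U})}.
  move=> fI F G FW GW; apply: (imset_inj_in fI).
    by move: FW; rewrite inE powersetE => /andP[].
  by move: GW; rewrite inE powersetE => /andP[].
split=> -[f [fI fW fC]]; exists f; split=> //.
  by rewrite CW imsetD_in ?fC ?imset_triples ?fW //; apply: inj.
by rewrite [RHS]Dc CW' imsetD_in ?fC ?imset_triples ?fW //; apply: inj.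
Qed.

(** The four conditions involve only circuits inside the union of [u] and [v],
    so they can be pulled back along [f]. *)
Lemma separated_induced (T U : finType) (C : {set {set T}}) (D : {set {set U}})
    (W : {set T}) (f : T -> U) :
  {in W &, injective f} -> [set f @: F | F : {set T} in C ::&: W] = D ->
  separated D -> separated C.
Proof.
move=> fI fC [u [v [uD vD vu sep]]].
move: uD vD; rewrite -{1 2}fC => /imsetP[u0] /[!inE] /andP[u0C u0W] ue.
move=> /imsetP[v0] /[!inE] /andP[v0C v0W] ve.
have sW : u0 :|: v0 \subset W by rewrite subUset u0W.
have eD : v :\: u = f @: (v0 :\: u0).
  rewrite ue ve; apply/setP => y; apply/setDP/imsetP => [[]|[x]].
    move=> /imsetP[x xv ->] xu; exists x => //; rewrite inE xv andbT.
    by apply: contra xu => xu; apply: imset_f.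
  rewrite inE => /andP[xu xv] ->; split; first exact: imset_f.
  apply: contra xu => /imsetP[x' x'u e].
  by rewrite (fI _ _ (subsetP v0W _ xv) (subsetP u0W _ x'u) e).
exists u0, v0; split=> //.
  by apply: leq_trans vu _; rewrite eD; apply: leq_imset_card.
move=> F FC Fuv; have FW := subset_trans Fuv sW.
have FD : f @: F \in D by rewrite -fC; apply/imsetP; exists F; rewrite // inE FC.
have [|e|/subsetP h] := sep _ FD; first by rewrite ue ve -imsetU imsetS.
  by left; apply: (imset_inj_in fI); rewrite ?powersetE // e.
right; apply/subsetP => x xvu.
have /imsetP[y yF e] : f x \in f @: F by apply: h; rewrite eD imset_f.
have xW : x \in W by apply: (subsetP v0W); move: xvu; rewrite inE => /andP[].
by rewrite (fI _ _ xW (subsetP FW _ yF) e).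
Qed.

Lemma in_tri a b c (x : 'I_7) : (a < 7)%N -> (b < 7)%N -> (c < 7)%N ->
  (x \in tri a b c) = [|| x == a :> nat, x == b :> nat | x == c :> nat].
Proof.
by move=> a7 b7 c7; rewrite !inE -!val_eqE /= !inordK // orbA.
Qed.

Lemma tri_eq a b c a' b' c' : (a < b < c)%N -> (c < 7)%N ->
  (a' < b' < c')%N -> (c' < 7)%N ->
  (tri a b c == tri a' b' c') = [&& a == a', b == b' & c == c'].
Proof.
move=> /andP[ab bc] c7 /andP[ab' bc'] c7'; apply/eqP/and3P => [/setP e|]; last first.
  by move=> [/eqP -> /eqP -> /eqP ->].
have in1 x : (x < 7)%N ->
    [|| x == a, x == b | x == c] = [|| x == a', x == b' | x == c'].
  by move=> x7; have := e (inord x); rewrite !in_tri ?inordK //; lia.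
have := in1 a; have := in1 b; have := in1 c.
have := in1 a'; have := in1 b'; have := in1 c'.
clear -ab bc c7 ab' bc' c7'; rewrite !eqxx !orbT /=; split; lia.
Qed.

Lemma card_tri a b c : (a < b < c)%N -> (c < 7)%N -> #|tri a b c| = 3%N.
Proof.
move=> /andP[ab bc] c7; rewrite /tri setUC cardsU1 cards2 !inE -!val_eqE /=.
by rewrite !inordK; lia.
Qed.

Lemma triP (F : {set 'I_7}) : #|F| = 3%N ->
  exists a b c, [/\ (a < b < c)%N, (c < 7)%N & F = tri a b c].
Proof.
move=> F3.
have [x xF] : exists x, x \in F by apply/set0Pn; rewrite -card_gt0 F3.
have : #|F :\ x| == 2%N by move: F3; rewrite (cardsD1 x) xF add1n => -[->].
case/cards2P => y [z [yz Fx]].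
have xyz : x \notin [set y; z] by rewrite -Fx setD11.
have FE : F = tri x y z by rewrite /tri !inord_val -setUA -Fx setD1K.
have tri_ex (a b c : nat) : (c < 7)%N -> (a < b < c)%N ->
    tri x y z = tri a b c -> exists a b c, [/\ (a < b < c)%N, (c < 7)%N & F = tri a b c].
  by move=> c7 abc e; exists a, b, c; rewrite FE e.
move: xyz yz; rewrite !inE negb_or -!val_eqE /= => /andP[xy xz] yz.
have [x7 y7 z7] : [/\ x < 7, y < 7 & z < 7]%N by split; apply: ltn_ord.
have perm (a b c : nat) : (a < 7)%N -> (b < 7)%N -> (c < 7)%N ->
    (forall w : nat, [|| w == x, w == y | w == z] = [|| w == a, w == b | w == c]) ->
    tri x y z = tri a b c.
  by move=> a7 b7 c7 e; apply/setP => w; rewrite !in_tri ?e.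
case: (ltngtP x y) xy => // xy _; case: (ltngtP y z) yz => // yz _;
  case: (ltngtP x z) xz => // xz _; try lia.
- by apply: (tri_ex x y z) => //; lia.
- by apply: (tri_ex x z y); [..|lia|apply: perm => // w; do 3 case: (w == _)].
- by apply: (tri_ex z x y); [..|lia|apply: perm => // w; do 3 case: (w == _)].
- by apply: (tri_ex y x z); [..|lia|apply: perm => // w; do 3 case: (w == _)].
- by apply: (tri_ex y z x); [..|lia|apply: perm => // w; do 3 case: (w == _)].
- by apply: (tri_ex z y x); [..|lia|apply: perm => // w; do 3 case: (w == _)].
Qed.

Definition vert (m : nat) : {set 'I_7} := [set i : 'I_7 | (0 < i <= m)%N].

Definition sorted_triples : seq (nat * nat * nat) :=
  [seq t <- [seq (ab, c) | ab <- [seq (a, b) | a <- iota 0 7, b <- iota 0 7],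
     c <- iota 0 7]
   | t.1.1 < t.1.2 < t.2]%N.

(** Clutters on at most six vertices are encoded by decidable relations on
    increasing triples of naturals, so that equalities between them follow by
    evaluation on [sorted_triples]. *)
Definition described (D : {set {set 'I_7}}) (r : nat -> nat -> nat -> bool) :=
  (forall G, G \in D -> #|G| = 3%N) /\
  forall a b c, (a < b < c)%N -> (c < 7)%N -> (tri a b c \in D) = r a b c.

Lemma all_sorted (r : nat -> nat -> nat -> bool) :
  all (fun t => r t.1.1 t.1.2 t.2) sorted_triples ->
  forall a b c, (a < b < c)%N -> (c < 7)%N -> r a b c.
Proof.
move=> /allP h a b c abc c7; apply: (h (a, b, c)).
rewrite mem_filter abc; apply/allpairsP; exists ((a, b), c).
split=> //; last by rewrite mem_iota.
by apply/allpairsP; exists (a, b); split=> //; rewrite mem_iota; move: abc; rewrite /=; lia.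
Qed.

Lemma described_eq D E r r' : described D r -> described E r' ->
  all (fun t => r t.1.1 t.1.2 t.2 == r' t.1.1 t.1.2 t.2) sorted_triples -> D = E.
Proof.
move=> [D3 Dr] [E3 Er] rr'; have e a b c (abc : (a < b < c)%N) (c7 : (c < 7)%N) :=
  all_sorted (r := fun a b c => r a b c == r' a b c) rr' abc c7.
apply/setP => F; have [/eqP/triP[a [b [c [abc c7 ->]]]]|F3] := boolP (#|F| == 3%N).
  by rewrite Dr // Er //; apply/eqP/e.
by apply/idP/idP => [/D3|/E3] /eqP; rewrite (negbTE F3).
Qed.

Lemma described_triples m : described (triples (vert m))
  (fun a b c => (0 < a)%N && (c <= m)%N).
Proof.
split=> [G|a b c abc c7]; first by rewrite inE => /andP[/eqP].
rewrite inE card_tri // eqxx /tri !subUset !sub1set !inE !inordK; lia.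
Qed.

Lemma describedD D E r r' : described D r -> described E r' ->
  described (D :\: E) (fun a b c => r a b c && ~~ r' a b c).
Proof.
move=> [D3 Dr] [E3 Er]; split=> [G|a b c abc c7].
  by rewrite inE => /andP[_ /D3].
by rewrite inE Dr // Er // andbC.
Qed.

Lemma described_cover D r m : described D r ->
  all (fun t => r t.1.1 t.1.2 t.2 ==> (0 < t.1.1)%N && (t.2 <= m)%N) sorted_triples ->
  all (fun i => has (fun t => r t.1.1 t.1.2 t.2 && (i \in [:: t.1.1; t.1.2; t.2]))
    sorted_triples) (iota 1 m) -> (m < 7)%N ->
  cover D = vert m.
Proof.
move=> [D3 Dr] le_m ex m7; apply/setP => i; apply/bigcupP/idP => [[G GD]|].
  have [a [b [c [abc c7 Ge]]]] := triP (D3 _ GD).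
  have := all_sorted (r := fun a b c => r a b c ==> (0 < a)%N && (c <= m)%N) le_m abc c7.
  move: GD; rewrite Ge Dr // => -> /=; rewrite in_tri ?inE; lia.
rewrite inE => im; have /(allP ex)/hasP[[[a b] c]] : (i : nat) \in iota 1 m.
  by rewrite mem_iota; lia.
rewrite mem_filter => /andP[abc /allpairsP[[[a' b'] c'] [_ c7 [_ _ ec]]]].
rewrite /= => /andP[rabc iabc].
have {}c7 : (c < 7)%N by move: c7; rewrite mem_iota ec.
exists (tri a b c); first by rewrite Dr.
by rewrite in_tri; move: abc iabc; rewrite ?inE /=; lia.
Qed.

Lemma missing_triplesE D r m E r' : described D r -> described E r' ->
  [&& all (fun t => r t.1.1 t.1.2 t.2 ==> (0 < t.1.1)%N && (t.2 <= m)%N) sorted_triples,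
   all (fun i => has (fun t => r t.1.1 t.1.2 t.2 && (i \in [:: t.1.1; t.1.2; t.2]))
     sorted_triples) (iota 1 m), (m < 7)%N &
   all (fun t => (0 < t.1.1)%N && (t.2 <= m)%N && ~~ r t.1.1 t.1.2 t.2 ==
     r' t.1.1 t.1.2 t.2) sorted_triples] ->
  cover D = vert m /\ missing_triples D = E.
Proof.
move=> Dr Er /and4P[h1 h2 h3 h4]; have cD := described_cover Dr h1 h2 h3.
split=> //; rewrite /missing_triples cD.
exact: described_eq (describedD (described_triples m) Dr) Er h4.
Qed.

(* an explicit list of triples: compare increasing triples componentwise *)
Ltac describe := split=> [G|a b c abc c7];
  [rewrite !inE -?orbA; do ?[case/orP]; move/eqP=> ->; exact: card_tri
  |by rewrite !inE !tri_eq // !xpair_eqE -!andbA -?orbA].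

Lemma described_B : described clutter_B (fun a b c => (a, b, c) \in
  [:: (1, 2, 3); (1, 2, 4); (1, 3, 4); (2, 3, 5); (2, 4, 5); (3, 4, 5)])%N.
Proof. describe. Qed.

Lemma described_B1 : described clutter_B1 (fun a b c => (a, b, c) \in
  [:: (1, 2, 3); (1, 2, 4); (1, 3, 4); (2, 3, 5); (2, 4, 5); (3, 4, 5);
      (1, 2, 5)])%N.
Proof. describe. Qed.

Lemma described_B2 : described clutter_B2 (fun a b c => (a, b, c) \in
  [:: (1, 2, 3); (1, 2, 4); (1, 3, 4); (2, 3, 5); (2, 4, 5); (3, 4, 5);
      (1, 2, 5); (1, 3, 5)])%N.
Proof. describe. Qed.

Lemma described_B' : described clutter_B' (fun a b c =>
  (0 < a)%N && ((a, b, c) \notin [:: (1, 2, 3); (4, 5, 6)])%N).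
Proof.
split=> [G|a b c abc c7]; first by rewrite !inE => /and3P[_ /eqP].
rewrite inE inE [in X in _ && X]inE card_tri // eqxx !inE !tri_eq //.
rewrite !xpair_eqE -!andbA andbC /= -!val_eqE /= !inordK; by lia.
Qed.

Definition missing_B : {set {set 'I_7}} :=
  tri 2 3 4 |: [set tri 1 2 5; tri 1 3 5; tri 1 4 5].
Definition missing_B1 : {set {set 'I_7}} :=
  tri 2 3 4 |: [set tri 1 3 5; tri 1 4 5].
Definition missing_B2 : {set {set 'I_7}} := tri 2 3 4 |: [set tri 1 4 5].
Definition missing_B' : {set {set 'I_7}} := [set tri 1 2 3; tri 4 5 6].

Lemma missing_BE : cover clutter_B = vert 5 /\ missing_triples clutter_B = missing_B.
Proof.
have dE : described missing_B (fun a b c => (a, b, c) \in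
  [:: (2, 3, 4); (1, 2, 5); (1, 3, 5); (1, 4, 5)])%N by describe.
exact: (missing_triplesE described_B dE).
Qed.

Lemma missing_B1E : cover clutter_B1 = vert 5 /\ missing_triples clutter_B1 = missing_B1.
Proof.
have dE : described missing_B1 (fun a b c => (a, b, c) \in
  [:: (2, 3, 4); (1, 3, 5); (1, 4, 5)])%N by describe.
exact: (missing_triplesE described_B1 dE).
Qed.

Lemma missing_B2E : cover clutter_B2 = vert 5 /\ missing_triples clutter_B2 = missing_B2.
Proof.
have dE : described missing_B2 (fun a b c => (a, b, c) \in
  [:: (2, 3, 4); (1, 4, 5)])%N by describe.
exact: (missing_triplesE described_B2 dE).
Qed.

Lemma missing_B'E : cover clutter_B' = vert 6 /\ missing_triples clutter_B' = missing_B'.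
Proof.
have dE : described missing_B' (fun a b c => (a, b, c) \in
  [:: (1, 2, 3); (4, 5, 6)])%N by describe.
exact: (missing_triplesE described_B' dE).
Qed.

Lemma separated_tri (E : {set {set 'I_7}}) a b c a' b' c' (x y : 'I_7) :
  tri a b c \in E -> tri a' b' c' \in E ->
  x != y -> x \in tri a' b' c' :\: tri a b c -> y \in tri a' b' c' :\: tri a b c ->
  (forall G, G \in E -> G = tri a b c \/ tri a' b' c' :\: tri a b c \subset G) ->
  separated E.
Proof.
move=> uE vE xy xvu yvu h; exists (tri a b c), (tri a' b' c'); split=> //.
  apply: (@leq_trans #|[set x; y]|); first by rewrite cards2 xy.
  by apply: subset_leq_card; rewrite subUset !sub1set xvu.
by move=> G /h.
Qed.

(* [u] is 234 and [v] is 145, so that [v :\: u] consists of 1 and 5 *)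
Ltac separate5 := apply: (@separated_tri _ 2 3 4 1 4 5 (inord 1) (inord 5));
  [by rewrite !inE eqxx|by rewrite !inE eqxx ?orbT|by rewrite -val_eqE /= !inordK
  |by rewrite in_setD !in_tri ?inordK|by rewrite in_setD !in_tri ?inordK
  |move=> G; rewrite !inE -?orbA => /orP[/eqP|]; [by left|];
   do ?[case/orP]; move/eqP=> ->; right; apply/subsetP => z;
   rewrite in_setD !in_tri //; by lia].

Lemma separated_B : separated missing_B. Proof. separate5. Qed.
Lemma separated_B1 : separated missing_B1. Proof. separate5. Qed.
Lemma separated_B2 : separated missing_B2. Proof. separate5. Qed.
Lemma separated_B' : separated missing_B'.
Proof.
apply: (@separated_tri _ 1 2 3 4 5 6 (inord 4) (inord 5)).
- by rewrite !inE eqxx.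
- by rewrite !inE eqxx orbT.
- by rewrite -val_eqE /= !inordK.
- by rewrite in_setD !in_tri ?inordK.
- by rewrite in_setD !in_tri ?inordK.
by move=> G; rewrite !inE => /orP[] /eqP ->; [left|right; apply: subsetDl].
Qed.

(** Listing the vertices of an induced subclutter as [s] names them
    [1, ..., size s], as the four clutters require. *)
Lemma index_embedding (T : finType) (s : seq T) (f := fun x => inord (index x s).+1 : 'I_7) :
  uniq s -> (size s < 7)%N ->
  {in [set x in s] &, injective f} /\ f @: [set x in s] = vert (size s).
Proof.
move=> us s7; have fv x : x \in s -> f x = (index x s).+1 :> nat.
  by rewrite -index_mem => xs; rewrite /f inordK //; apply: leq_ltn_trans xs s7.
split=> [x y|].
  rewrite !inE => xs ys /(congr1 val) /=; rewrite !fv // => -[e].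
  by rewrite -(nth_index x xs) e nth_index.
apply/setP => i; apply/imsetP/idP => [[x]|].
  by rewrite !inE => xs ->; rewrite fv //= index_mem.
rewrite inE => /andP[i0 im]; case: s us s7 @f fv im => [|x0 s] us s7 f fv im.
  by move: i0; rewrite ltnNge im.
have i1 : (i.-1 < size (x0 :: s))%N by rewrite prednK.
exists (nth x0 (x0 :: s) i.-1); first by rewrite inE mem_nth.
by apply/val_inj; rewrite /= fv ?mem_nth // index_uniq // prednK.
Qed.

(** Adapted to [X] being the set of [x] for which [x], with two fixed vertices,
    is a circuit: the order makes the three possible cases match the three
    clutters on five vertices. *)
Lemma arrange3 (T : finType) (u X : {set T}) : #|u| = 3%N -> X \subset u -> X != set0 ->
  exists a b c, [/\ uniq [:: a; b; c], u = [set a; b; c] &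
    [\/ X = [set c], X = [set b; c] | X = [set a; b; c]]].
Proof.
move=> u3 Xu /set0Pn[c cX]; have cu := subsetP Xu _ cX.
have : #|u :\ c| == 2%N by move: u3; rewrite (cardsD1 c) cu add1n => -[->].
case/cards2P => a [b [ab uc]].
have cab : c \notin [set a; b] by rewrite -uc setD11.
have uE : u = [set a; b; c] by rewrite setUC -uc setD1K.
move: (cab); rewrite !inE negb_or => /andP[ca cb].
have XE x : (x \in X) = [|| (a \in X) && (x == a), (b \in X) && (x == b) | x == c].
  apply/idP/idP => [xX|/or3P[/andP[aX /eqP->]|/andP[bX /eqP->]|/eqP->]] //.
  have := subsetP Xu _ xX; rewrite uE !inE -orbA.
  by case/or3P => /eqP e; move: xX; rewrite e eqxx => xX; rewrite ?xX ?orbT.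
have [aX|aX] := boolP (a \in X); have [bX|bX] := boolP (b \in X).
- exists a, b, c; split=> //; first by rewrite /= !inE negb_or ab eq_sym ca eq_sym cb.
  by constructor 3; apply/setP => x; rewrite XE aX bX !inE orbA.
- exists b, a, c; split; first by rewrite /= !inE negb_or eq_sym ab eq_sym cb eq_sym ca.
    by rewrite [[set b; a]]setUC.
  by constructor 2; apply/setP => x; rewrite XE aX (negbTE bX) !inE.
- exists a, b, c; split=> //; first by rewrite /= !inE negb_or ab eq_sym ca eq_sym cb.
  by constructor 2; apply/setP => x; rewrite XE bX (negbTE aX) !inE.
- exists a, b, c; split=> //; first by rewrite /= !inE negb_or ab eq_sym ca eq_sym cb.
  by constructor 1; apply/setP => x; rewrite XE (negbTE aX) (negbTE bX) !inE.
Qed.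

Lemma clutter_family_missing D : D \in clutter_family ->
  (forall G, G \in D -> #|G| = 3%N) /\ separated (missing_triples D).
Proof.
rewrite !inE => /or4P[] /eqP ->.
- by have [_ ->] := missing_BE; split; [exact: described_B.1|exact: separated_B].
- by have [_ ->] := missing_B1E; split; [exact: described_B1.1|exact: separated_B1].
- by have [_ ->] := missing_B2E; split; [exact: described_B2.1|exact: separated_B2].
- by have [_ ->] := missing_B'E; split; [exact: described_B'.1|exact: separated_B'].
Qed.

(** If [v :\: u] is [d; e], each circuit other than [u] is [d; x; e] with [x] in
    [u]; sending [d], [u], [e] to 1, 234, 5 gives the clutter with one, two or
    three such circuits.  If [v :\: u] has three elements, only [u] and [v] are
    left. *)
Lemma separated_forbidden (T : finType) (C : {set {set T}}) :
  (forall F, F \in C -> #|F| = 3%N) -> separated C ->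
  exists W D, D \in clutter_family /\ induced_iso (complement3 C) W D.
Proof.
move=> C3 [u [v [uC vC vu sep]]].
have emb D E (s : seq T) (f := fun x => inord (index x s).+1 : 'I_7) :
    D \in clutter_family -> cover D = vert (size s) /\ missing_triples D = E ->
    uniq s -> (size s < 7)%N -> u :|: v = [set x in s] ->
    [set f @: F | F : {set T} in C ::&: (u :|: v)] = E ->
    exists W D, D \in clutter_family /\ induced_iso (complement3 C) W D.
  move=> DF [cD eD] us s7 Ws fE; exists (u :|: v), D; split=> //.
  apply/(induced_iso_complement _ C3 (clutter_family_missing DF).1).
  have [fI fW] := index_embedding us s7.
  by exists f; rewrite Ws cD eD -Ws; split=> //; rewrite Ws.
have UDE : u :|: v = u :|: (v :\: u).
  by apply/setP => x; rewrite !inE; case: (x \in u).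
have [vu2|vu3] : #|v :\: u| = 2%N \/ #|v :\: u| = 3%N.
- have := subset_leq_card (subsetDl v u); rewrite (C3 _ vC); move: vu; clear; lia.
- have /eqP/cards2P[d [e [de vuE]]] := vu2.
  have [d_u e_u] : d \notin u /\ e \notin u.
    have: d \in v :\: u by rewrite vuE !inE eqxx.
    have: e \in v :\: u by rewrite vuE !inE eqxx orbT.
    by rewrite !in_setD => /andP[-> _] /andP[-> _].
  pose g x := [set d; x; e].
  pose X := [set x in u | g x \in C].
  have gX F : F \in C -> F \subset u :|: v -> v :\: u \subset F ->
      exists2 x, x \in X & F = g x.
    move=> FC FW; rewrite vuE => deF.
    have : #|F :\: [set d; e]| == 1%N.
      by rewrite cardsD (setIidPr deF) cards2 de C3.
    case/cards1P => x Fx.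
    have FE : F = g x.
      rewrite -(setID F [set d; e]) (setIidPr deF) Fx /g.
      by rewrite -setUA [[set e] :|: _]setUC setUA.
    exists x => //; rewrite inE -FE FC andbT.
    have : x \in F :\: [set d; e] by rewrite Fx inE.
    rewrite inE => /andP[xde xF]; have := subsetP FW _ xF.
    by rewrite UDE vuE inE (negbTE xde) orbF.
  have XN : X != set0.
    have [x xX _] := gX v vC (subsetUr _ _) (subsetDl _ _).
    by apply/set0Pn; exists x.
  have Xu : X \subset u by apply/subsetP => x; rewrite inE => /andP[].
  have CW : C ::&: (u :|: v) = u |: (g @: X).
    apply/setP => F; rewrite !inE; apply/andP/orP => [[FC FW]|].
      have [->|/(gX F FC FW)[x xX ->]] := sep F FC FW; first by left.
      by right; apply: imset_f.
    case=> [/eqP ->|/imsetP[x]]; first by rewrite subsetUl.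
    rewrite inE => /andP[xu gC] ->; split=> //.
    by rewrite UDE vuE !subUset !sub1set !inE xu !eqxx ?orbT.
  have [a [b [c [uabc uE XE]]]] := arrange3 (C3 _ uC) Xu XN.
  pose s := [:: d; a; b; c; e].
  have us : uniq s.
    move: d_u e_u uabc; rewrite uE /= !inE !negb_or.
    move=> /andP[/andP[-> ->] ->] /andP[/andP[ea eb] ec] /andP[/andP[-> ->]].
    by rewrite de ![_ == e]eq_sym ea eb ec => /andP[->].
  have Ws : u :|: v = [set x in s].
    rewrite UDE vuE uE; apply/setP => x; rewrite !inE.
    by do 5 case: (x == _).
  pose f x := inord (index x s).+1 : 'I_7.
  have fs i : (i < 5)%N -> f (nth d s i) = inord i.+1.
    by move=> i5; rewrite /f index_uniq.
  have fg x : f @: g x = [set inord 1; f x; inord 5].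
    by rewrite /g !imsetU !imset_set1 (fs 0%N isT) (fs 4 isT).
  have fu : f @: u = tri 2 3 4.
    by rewrite uE !imsetU !imset_set1 (fs 1%N isT) (fs 2 isT) (fs 3 isT).
  have fC : [set f @: F | F : {set T} in C ::&: (u :|: v)] =
      tri 2 3 4 |: [set [set inord 1; f x; inord 5] | x in X].
    by rewrite CW imsetU imset_set1 fu -imset_comp; under eq_imset => x do rewrite /= fg.
  case: XE => XE; move: fC;
    rewrite XE ?imsetU !imset_set1 ?(fs 1%N isT) ?(fs 2 isT) (fs 3 isT) => fC.
  + by apply: (emb clutter_B2 _ s _ missing_B2E us isT Ws fC); rewrite !inE eqxx ?orbT.
  + by apply: (emb clutter_B1 _ s _ missing_B1E us isT Ws fC); rewrite !inE eqxx ?orbT.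
  + by apply: (emb clutter_B _ s _ missing_BE us isT Ws fC); rewrite !inE eqxx ?orbT.
have vuE : v :\: u = v by apply/eqP; rewrite eqEcard subsetDl vu3 C3.
have CW : C ::&: (u :|: v) = [set u; v].
  apply/setP => F; rewrite !inE; apply/andP/orP => [[FC FW]|].
    have [->|vF] := sep F FC FW; first by left.
    by right; rewrite eq_sym eqEcard -{1}vuE vF !C3.
  by case=> /eqP ->; rewrite ?subsetUl ?subsetUr.
have neq0 (F : {set T}) : F \in C -> F != set0.
  by move=> /C3; apply: contra_eq_neq => ->; rewrite cards0.
have [a [b [c [uabc uE _]]]] := arrange3 (C3 _ uC) (subxx _) (neq0 _ uC).
have [d [e [h [vdeh vE _]]]] := arrange3 (C3 _ vC) (subxx _) (neq0 _ vC).
pose s := [:: a; b; c; d; e; h].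
have us : uniq s.
  rewrite -[s]/([:: a; b; c] ++ [:: d; e; h]) cat_uniq uabc vdeh andbT.
  apply/hasPn => x xv; have : x \in v by rewrite vE !inE -orbA in xv *.
  by rewrite -vuE uE !inE -orbA => /andP[].
have Ws : u :|: v = [set x in s].
  by rewrite uE vE; apply/setP => x; rewrite !inE -!orbA.
pose f x := inord (index x s).+1 : 'I_7.
have fs i : (i < 6)%N -> f (nth a s i) = inord i.+1.
  by move=> i6; rewrite /f index_uniq.
have fC : [set f @: F | F : {set T} in C ::&: (u :|: v)] = missing_B'.
  rewrite CW imsetU !imset_set1 uE vE !imsetU !imset_set1.
  by rewrite (fs 0%N isT) (fs 1%N isT) (fs 2 isT) (fs 3 isT) (fs 4 isT) (fs 5 isT).
by apply: (emb clutter_B' _ s _ missing_B'E us isT Ws fC); rewrite !inE eqxx ?orbT.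
Qed.

Lemma clutter_freeP (T : finType) (C : {set {set T}}) :
  (forall F, F \in C -> #|F| = 3%N) ->
  clutter_free clutter_family (complement3 C) <-> ~ separated C.
Proof.
move=> C3; split=> [free sep|nsep [W [D [DF iso]]]].
  exact/free/separated_forbidden.
have [D3 sepD] := clutter_family_missing DF.
have [f [fI _ fC]] := (induced_iso_complement W C3 D3).1 iso.
exact: nsep (separated_induced fI fC sepD).
Qed.

End Forbidden.

(** * The equivalence of the two conditions *)

Theorem proposition2p4 (K : fieldType) (n : nat) (C : {set {set 'I_n}})
    (hC : uniform3_clutter C) (hC0 : C != finset.set0) :
  clutter_free clutter_family (complement3 C) <->
  exists k : nat, (1 <= k)%N /\
    (EFin 1%R < GL_index (ideal_exp (edge_ideal K C) k))%O.
Proof.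
have [C3 _] := hC; apply: (iff_trans (clutter_freeP C3)); split.
  move=> nsep; exists 1%N; split=> //; apply/GL_index_gt1; exists 3%N.
  rewrite edge_ideal_exp; split; first exact: circuit_mon_generated C3.
  move=> [|[|//]] j _ j3; last exact: not_separated_betti.
  apply: betti0_eq0 => m /circuit_mon1P[F FC Fm] mj.
  have [k Fk] : exists k, (mesym1 F k < m k)%N.
    apply/existsP; apply: contraTT j3 => /existsPn h.
    rewrite -leqNgt -mj add0n -(C3 F FC) -mdeg_mesym1 !mdegE.
    by apply: leq_sum => i _; rewrite leqNgt.
  exists k; first exact: leq_ltn_trans Fk.
  apply/circuit_mon1P; exists F => //; apply/mnm_lepP => i.
  rewrite mnmBE mnm1E; case: eqVneq => [<-|_]; last by rewrite subn0 (mnm_lepP Fm).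
  by rewrite -ltnS subn1 prednK // (leq_ltn_trans _ Fk).
move=> [k [k1 /GL_index_gt1[d]]]; case: k k1 => // k _.
rewrite edge_ideal_exp => -[gd b0] sep.
have [j j3 bj] := separated_betti K k C3 sep.
have [F FC] := set0Pn _ hC0.
have dk : (d <= k.+1 * 3)%N.
  have /(generated_in_degree_le gd) : circuit_mon C k.+1 (\sum_(G <- nseq k.+1 F) mesym1 G)%MM.
    exists (nseq k.+1 F); split; [|by rewrite size_nseq|exact: lepm_refl].
    by move=> G; rewrite mem_nseq => /andP[_ /eqP ->].
  by rewrite (mdeg_sum_mesym1 C3) ?size_nseq // => G; rewrite mem_nseq => /andP[_ /eqP ->].
by apply/bj/b0 => //; lia.
Qed.
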